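(* Let $\alpha\in(0,1)$ and suppose that condition $Hp.G(R,d,f,r)$ holds, with $c:=r+2f^{\alpha}<\frac14$. Put $\bar c:=\frac12-\sqrt{\frac14-c}$ and $\varepsilon_1:=4\left[\bar c+2f+f^{\alpha}+d\right]$. Then for any $x\in B_\alpha$, $$d_{TV}\left(\mu^{(em)\,x}_A,\pi_A\right)<\varepsilon_1 .$$
   Context: Setting. $\mathcal X$ is a finite set and $X=(X_t)_{t\ge0}$ is an irreducible continuous-time Markov chain on $\mathcal X$ with transition rates $Q$ and invariant probability measure $\pi$; reversibility is not assumed. $X^{\leftarrow}$ denotes the time-reversed chain, with rates $Q^*(x,y)=\frac{\pi(y)}{\pi(x)}Q(y,x)$. A superscript $x$ (or a probability measure $\nu$) denotes the starting point (or initial law); $\tau^x_K=\inf\{t\ge0: X^x_t\in K\}$, and $\tau^{\leftarrow x}_K$ is the same for $X^{\leftarrow}$. $G\subset\mathcal X$ is a target set, $A:=\mathcal X\setminus G$, and $\pi_A(\cdot)=\pi(\cdot)\mathbf 1_{\{\cdot\in A\}}/\pi(A)$. $d_{TV}(\pi_1,\pi_2)=\frac12\sum_{x}|\pi_1(x)-\pi_2(x)|$, $\mu^x_t(\cdot)=\mathbf P(X^x_t=\cdot)$, and for $K\subset\mathcal X$, $\bar d_K(t)=\max_{x,x'\in K}d_{TV}(\mu^x_t,\mu^{x'}_t)$. Hypotheses. Let $f_A(t):=\mathbf P(\tau_G^{\pi_A}\le t)=\frac12\sum_{x\in A}\pi_A(x)\left[\mathbf P(\tau_G^x\le t)+\mathbf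 P(\tau_G^{\leftarrow x}\le t)\right]$. For $R>1$, $d,f,r\in(0,1)$ and $\alpha\in(0,1)$: - $E(R,f)$ (slow escape): $f_A(2R)\le f$. - $B_\alpha:=\left\{x\in A:\ \frac12\left[\mathbf P(\tau_G^x\le2R)+\mathbf P(\tau_G^{\leftarrow x}\le2R)\right]\le f^\alpha\right\}$. - $T(R,d)$ (fast thermalization): $\bar d_{B_\alpha}(R)\le d$. - $Rc(R,r)$ (fast recurrence): $\sup_{x\in\mathcal X}\mathbf P(\tau^x_{B_\alpha\cup G}>R)<r$. - $Hp.G(R,d,f,r)$: $E(R,f)$, $T(R,d)$ and $Rc(R,r)$ hold simultaneously. Empirical measure: for $x\in A$, $\mu^{(em)\,x}_A(y)=\dfrac{\mathbf E\,\xi^x_G(y)}{\mathbf E\,\tau^x_G}$, where $\xi^x_G(y)=\int_0^{\tau^x_G}\mathbf 1_{\{X^x_s=y\}}\,ds$ is the local time spent in $y$ before $\tau_G$ starting at $x$. *)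

(* Defs.v *)
From HB Require Import structures.
From mathcomp Require Import all_boot all_order all_algebra.
From mathcomp Require Import all_classical all_reals all_analysis.

Set Implicit Arguments.
Unset Strict Implicit.
Unset Printing Implicit Defensive.

Import Order.TTheory GRing.Theory Num.Theory.
Import numFieldNormedType.Exports.

Local Open Scope classical_set_scope.
Local Open Scope ring_scope.

Section rates.
Context {R : realType} {S : finType}.
Implicit Types (Q : S -> S -> R) (pi nu : S -> R).

(* Transition rates are given as a full generator: the off-diagonal entries
   are the jump rates and [Q x x] is minus the total jump rate out of [x]. *)
Definition is_generator Q : Prop :=
  (forall x y, x != y -> 0 <= Q x y) /\ (forall x, \sum_y Q x y = 0).

Definition irreducible_rates Q : Prop :=
  forall x y, connect [rel a b | 0 < Q a b] x y.

Definition is_prob nu : Prop :=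
  (forall x, 0 <= nu x) /\ \sum_x nu x = 1.

Definition invariant_prob Q pi : Prop :=
  is_prob pi /\ (forall y, \sum_x pi x * Q x y = 0).

Definition reversed_rates Q pi : S -> S -> R :=
  fun x y => pi y / pi x * Q y x.

Fixpoint rate_pow Q (k : nat) : S -> S -> R :=
  if k is k'.+1 then fun x y => \sum_z Q x z * rate_pow Q k' z y
  else fun x y => (x == y)%:R.

(* The entry (x, y) of the matrix exponential e^(tQ). *)
Definition transition Q (t : R) (x y : S) : R :=
  limn (series (fun k => exp_coeff t k * rate_pow Q k x y)).

Definition point_law (x : S) : S -> R := fun y => (y == x)%:R.

Definition restricted_law pi (A : {set S}) : S -> R :=
  fun x => pi x * (x \in A)%:R / \sum_(y in A) pi y.

Definition d_TV (p1 p2 : S -> R) : R := 2^-1 * \sum_x `|p1 x - p2 x|.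

End rates.

Section process.
Context {R : realType} {S : finType} {d : measure_display}
  {Omega : measurableType d}.
Variable P : probability Omega R.
Implicit Types (X : R -> Omega -> S) (K : {set S}).

(* [X] is a right-continuous Markov chain with generator [Q] and initial law
   [nu]; only the times [t >= 0] are constrained. *)
Record is_markov_chain (Q : S -> S -> R) (nu : S -> R) X : Prop := {
  mc_measurable : forall t y, 0 <= t -> measurable [set w | X t w = y] ;
  mc_right_continuous : forall w t, 0 <= t ->
    exists2 e : R, 0 < e & forall s, t <= s < t + e -> X s w = X t w ;
  mc_finite_dim : forall (n : nat) (t : nat -> R) (z : nat -> S),
    t 0%N = 0 -> (forall i, t i <= t i.+1) ->
    P [set w | forall i, (i <= n)%N -> X (t i) w = z i] =
    (nu (z 0%N) *
     \prod_(i < n) transition Q (t i.+1 - t i) (z i) (z i.+1))%:E }.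

(* [Y nu] is the chain started from the initial law [nu]. *)
Definition is_markov_family (Q : S -> S -> R)
    (Y : (S -> R) -> R -> Omega -> S) : Prop :=
  forall nu, is_prob nu -> is_markov_chain Q nu (Y nu).

Definition hit X K (w : Omega) : \bar R :=
  ereal_inf [set t%:E | t in [set t : R | 0 <= t /\ X t w \in K]].

Definition prob_hit_le X K (t : R) : R :=
  fine (P [set w | (hit X K w <= t%:E)%E]).

Definition prob_hit_gt X K (t : R) : R :=
  fine (P [set w | (t%:E < hit X K w)%E]).

Definition law_at X (t : R) : S -> R :=
  fun y => fine (P [set w | X t w = y]).

Definition local_time X K (y : S) (w : Omega) : \bar R :=
  (\int[lebesgue_measure]_(s in [set s : R | (0 <= s)%R /\ s%:E < hit X K w])
     ((X s w == y)%:R)%:E)%E.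

(* Both expectations are finite, and the second one is positive, when the
   chain is irreducible, [K] is nonempty and the chain starts outside [K]. *)
Definition empirical_law X K : S -> R :=
  fun y => fine (\int[P]_w local_time X K y w)%E
         / fine (\int[P]_w hit X K w)%E.

End process.

Section hypotheses.
Context {R : realType} {S : finType} {d : measure_display}
  {Omega : measurableType d}.
Variables (P : probability Omega R) (pi : S -> R) (G : {set S}).
(* The families of forward and time-reversed chains, by initial law. *)
Variables X Xrev : (S -> R) -> R -> Omega -> S.

Definition escape_prob (t : R) : R :=
  prob_hit_le P (X (restricted_law pi (~: G))) G t.

Definition basin (alpha Rt f : R) : {set S} :=
  finset (fun x => (x \in ~: G) &&
    (2^-1 * (prob_hit_le P (X (point_law x)) G (2 * Rt)
             + prob_hit_le P (Xrev (point_law x)) G (2 * Rt)) <= f `^ alpha)).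

(* The maximum over an empty [K] is [0]. *)
Definition d_bar (K : {set S}) (t : R) : R :=
  \big[Num.max/0]_(x in K) \big[Num.max/0]_(x' in K)
    d_TV (law_at P (X (point_law x)) t) (law_at P (X (point_law x')) t).

Definition slow_escape (Rt f : R) : Prop := escape_prob (2 * Rt) <= f.

Definition fast_thermalization (alpha f Rt dd : R) : Prop :=
  d_bar (basin alpha Rt f) Rt <= dd.

Definition fast_recurrence (alpha f Rt r : R) : Prop :=
  sup (range (fun x : S =>
    prob_hit_gt P (X (point_law x)) (basin alpha Rt f :|: G) Rt)) < r.

Definition HpG (alpha Rt dd f r : R) : Prop :=
  [/\ slow_escape Rt f, fast_thermalization alpha f Rt dd
    & fast_recurrence alpha f Rt r].

End hypotheses.

(* Main.v *)
(* Discretise time with mesh [h = Rt / 2^n] and let [p] be the one-step matrix.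
   The empirical law of the killed skeleton is [psi |-> u x / e x], where
   [u = psi + p_G u] and [e = 1 + p_G e] on the complement A of G ([p_G] being [p]
   killed on G). Put [w = u - (u x / e x) e]. The defect [pi_A - pi_A p_G] is
   nonnegative, because [pi] is invariant, and pairing it with [w] yields exactly
   [pi_A psi - u x / e x]. It thus suffices to bound [w] from above: on the basin
   B, mixing at time [Rt] makes [w] small compared with the exit time [e], since
   the trajectories from two points of B can be coupled up to a time shift and
   shifts are negligible for time averages; on A \ B a maximum principle, based
   on the recurrence hypothesis, compares [w] with a multiple of [e] plus the time
   needed to reach B or G. The defect maps [e] to 1, and the second term to at most
   [f / (1 - r)] by slow escape. Right-continuity of the paths lets [n] go to
   infinity. *)
Require Import Defs.
From HB Require Import structures.
From mathcomp Require Import all_boot all_order all_algebra.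
From mathcomp Require Import all_classical all_reals all_analysis.
From mathcomp Require Import measurable_realfun ring lra.

Set Implicit Arguments.
Unset Strict Implicit.
Unset Printing Implicit Defensive.

Import Order.TTheory GRing.Theory Num.Theory.
Import numFieldNormedType.Exports.

Local Open Scope classical_set_scope.
Local Open Scope ring_scope.

(** * Substochastic matrices killed on a set *)

(** Bounding [w] on one side is enough because the supremum of [pi_A psi - u x / e x] over test
    functions [psi] with values in [0,1] is the whole total variation distance. Time shifts are
    negligible because exit from B is slow on the scale [Rt]. From the point of B where [e] is
    least, the first [N] steps contribute almost [N]; by recurrence the chain then revisits B, where
    the remaining exit time is again at least this minimum. Comparing the minimum with itself gives
    [(1 - eta) N <= (r + eta) e]. The argument consumes two periods, hence the horizon 2R. Here
    [eta] is [2 f^alpha], as the basin bounds the mean of two hitting probabilities. The mesh is not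
    neutral: a skeleton can only miss visits. Lower bounds on survival (escape, basin) therefore
    hold on every mesh, whereas the recurrence bound, an upper bound on survival, holds only on fine
    meshes and relies on its strict inequality. *)

Section killed_operator.
Context {R : realFieldType} {S : finType}.
Implicit Types (p : S -> S -> R) (K : {set S}) (u v : S -> R).

(** Only the arrival state is tested, so a start inside [K] is not killed at time 0:
    [survival p K k x] is the probability that times 1 to [k] avoid [K]. *)
Definition killed p K u : S -> R := fun x => \sum_(z | z \notin K) p x z * u z.

Definition survival p K (k : nat) : S -> R := iter k (killed p K) (fun=> 1).

Definition killed_pow p K (k : nat) (x y : S) : R :=
  iter k (killed p K) (fun z => (z == y)%:R) x.

Lemma killedD p K u v x :
  killed p K (fun z => u z + v z) x = killed p K u x + killed p K v x.
Proof. by rewrite -big_split; apply: eq_bigr => z _; rewrite mulrDr. Qed.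

Lemma killedZ p K a u x :
  killed p K (fun z => a * u z) x = a * killed p K u x.
Proof. by rewrite mulr_sumr; apply: eq_bigr => z _; rewrite mulrCA. Qed.

Lemma killedB p K u v x :
  killed p K (fun z => u z - v z) x = killed p K u x - killed p K v x.
Proof. by rewrite -sumrB; apply: eq_bigr => z _; rewrite mulrBr. Qed.

Lemma killed_sum p K n (u : nat -> S -> R) x :
  killed p K (fun z => \sum_(i < n) u i z) x = \sum_(i < n) killed p K (u i) x.
Proof.
by rewrite exchange_big; apply: eq_bigr => z _; rewrite mulr_sumr.
Qed.

Lemma iter_killedE p K k u x :
  iter k (killed p K) u x = \sum_y killed_pow p K k x y * u y.
Proof.
elim: k x => [|k IHk] x.
  rewrite /killed_pow /= (bigD1 x) //= eqxx mul1r big1 ?addr0 // => y.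
  by rewrite eq_sym => /negbTE ->; rewrite mul0r.
rewrite iterS {1}/killed.
under eq_bigr do rewrite IHk mulr_sumr.
rewrite exchange_big; apply: eq_bigr => y _.
rewrite [RHS]mulr_suml; apply: eq_bigr => z _.
by rewrite mulrA.
Qed.

Lemma survivalE p K k x : survival p K k x = \sum_y killed_pow p K k x y.
Proof.
by rewrite /survival iter_killedE; apply: eq_bigr => y _; rewrite mulr1.
Qed.

Section stochastic.
Variables (p : S -> S -> R).
Hypotheses (p_ge0 : forall x y, 0 <= p x y) (p_sum1 : forall x, \sum_y p x y = 1).
Variable K : {set S}.

Lemma killed_le u v : (forall z, z \notin K -> u z <= v z) ->
  forall x, killed p K u x <= killed p K v x.
Proof. by move=> uv x; apply: ler_sum => z zK; rewrite ler_wpM2l ?uv. Qed.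

Lemma iter_killed_le k u v : (forall z, z \notin K -> u z <= v z) ->
  forall x, x \notin K -> iter k (killed p K) u x <= iter k (killed p K) v x.
Proof. by move=> uv; elim: k => //= k IHk x xK; apply: killed_le. Qed.

Lemma killed_const_le a x : 0 <= a -> killed p K (fun=> a) x <= a.
Proof.
move=> a0; rewrite -[leRHS]mul1r -(p_sum1 x) mulr_suml.
rewrite [leRHS](bigID (fun z => z \notin K)) /= lerDl.
by apply: sumr_ge0 => z _; rewrite mulr_ge0.
Qed.

Lemma killed_ge0 u : (forall z, z \notin K -> 0 <= u z) ->
  forall x, 0 <= killed p K u x.
Proof. by move=> u0 x; apply: sumr_ge0 => z zK; rewrite mulr_ge0 ?u0. Qed.

Lemma iter_killed_ge0 k u : (forall z, 0 <= u z) ->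
  forall x, 0 <= iter k (killed p K) u x.
Proof. by move=> u0; elim: k => //= k IHk x; apply: killed_ge0 => z _. Qed.

Lemma killed_pow_ge0 k x y : 0 <= killed_pow p K k x y.
Proof. exact: iter_killed_ge0. Qed.

Lemma survival_ge0 k x : 0 <= survival p K k x.
Proof. exact: iter_killed_ge0. Qed.

Lemma survival_decr k x : survival p K k.+1 x <= survival p K k x.
Proof.
elim: k x => [|k IHk] x; first exact: killed_const_le.
by apply: killed_le => z _; apply: IHk.
Qed.

Lemma survival_anti m n x : (m <= n)%N -> survival p K n x <= survival p K m x.
Proof.
move=> /subnK <-; elim: (n - m)%N => //= k IHk.
exact: le_trans (survival_decr _ _) IHk.
Qed.

Lemma survival_le1 k x : survival p K k x <= 1.
Proof. exact: (@survival_anti 0). Qed.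

Lemma killed_pow_le_free k x y : killed_pow p K k x y <= killed_pow p finset.set0 k x y.
Proof.
elim: k x => // k IHk x; rewrite /killed_pow !iterS.
apply: (@le_trans _ _ (killed p K (killed_pow p finset.set0 k ^~ y) x)).
  by apply: killed_le => z _; apply: IHk.
rewrite /killed [leRHS](bigID (fun z => z \notin K)) /=.
apply: ler_wpDr; last first.
  by rewrite le_eqVlt; apply/orP; left; apply/eqP; apply: eq_bigl => z; rewrite inE.
apply: sumr_ge0 => z _; rewrite mulr_ge0 //.
elim: k z {IHk} => //= k IHk z; apply: sumr_ge0 => t _; exact: mulr_ge0.
Qed.

Lemma survival_free k x : survival p finset.set0 k x = 1.
Proof.
elim: k x => //= k IHk x; rewrite /survival /= -[RHS](p_sum1 x) /killed.
rewrite (eq_bigl xpredT) => [|z]; last by rewrite inE.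
by apply: eq_bigr => z _; rewrite -/(survival _ _ _) IHk mulr1.
Qed.

Lemma iter_expand k u psi :
  (forall x, x \notin K -> u x = psi x + killed p K u x) ->
  forall x, x \notin K -> u x = \sum_(i < k) iter i (killed p K) psi x
                               + iter k (killed p K) u x.
Proof.
move=> eq_u; elim: k => [|k IHk] x xK; first by rewrite big_ord0 add0r.
rewrite {1}eq_u // big_ord_recl /= -addrA; congr (_ + _).
rewrite -killed_sum -killedD; apply: eq_bigr => z zK.
by rewrite {1}IHk.
Qed.

(* Maximum principle: iterating the hypothesis [N] times contracts [sup v] by [r]. *)
Lemma killed_max_principle N r v : r < 1 ->
  (forall y, y \notin K -> survival p K N y <= r) ->
  (forall y, y \notin K -> v y <= killed p K v y) ->
  forall y, y \notin K -> v y <= 0.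
Proof.
move=> r1 Nr vk y yK; rewrite leNgt; apply/negP => vy.
case: (@arg_maxP _ _ _ y (fun y => y \notin K) v yK) => z zK zmax.
have vz : 0 < v z := lt_le_trans vy (zmax y yK).
have vi k x : x \notin K -> v x <= iter k (killed p K) v x.
  elim: k x => //= k IHk x xK.
  by apply: (le_trans (vk x xK)); apply: killed_le.
have := vi N z zK; rewrite leNgt => /negP; apply.
apply: (@le_lt_trans _ _ (v z * r)); last by rewrite gtr_pMr.
apply: (@le_trans _ _ (iter N (killed p K) (fun=> v z) z)).
  by apply: iter_killed_le.
rewrite iter_killedE -mulr_suml -survivalE mulrC ler_wpM2l ?Nr //.
exact: ltW.
Qed.

End stochastic.
End killed_operator.

(** * The occupation estimate for a discrete-time chain *)

Section quasi_ergodic_bound.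
Variables (R : realFieldType) (S : finType) (p : S -> S -> R) (G B : {set S}).
Variables (pA : S -> R) (N : nat) (eta d f r : R).
Hypotheses (p_ge0 : forall x y, 0 <= p x y) (p_sum1 : forall x, \sum_y p x y = 1).
Hypothesis BG : forall z, z \in B -> z \notin G.
Hypotheses (pA_ge0 : forall y, 0 <= pA y).
Hypotheses (pA_G : forall y, y \in G -> pA y = 0) (pA_sum1 : \sum_y pA y = 1).
Hypothesis pA_sub : forall y, y \notin G -> \sum_x pA x * p x y <= pA y.
Hypothesis escape : 1 - f <= \sum_x pA x * survival p G N x.
Hypothesis basin_survival : forall z, z \in B -> 1 - eta <= survival p G (N + N) z.
Hypothesis recurrence : forall y, y \notin B :|: G -> survival p (B :|: G) N y <= r.
Hypothesis mixing : forall z x, z \in B -> x \in B ->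
  \sum_y `|killed_pow p finset.set0 N z y - killed_pow p finset.set0 N x y| <= 2 * d.
Hypotheses (N_gt0 : (0 < N)%N) (eta_ge0 : 0 <= eta) (r_ge0 : 0 <= r) (r_lt1 : r < 1).

Lemma basin_survivalN z : z \in B -> 1 - eta <= survival p G N z.
Proof.
by move=> /basin_survival /le_trans; apply; rewrite survival_anti ?leq_addr.
Qed.

(** Killing removes mass at most [eta] from each of the two free kernels ([a] and [b]), and the
    positive and negative parts of the free difference [D] have mass at most [d]. So a mass at most
    [d + eta] is weighted by at most [hi], and another one, subtracted, by at least [lo]; the signs
    of [lo] and [hi] allow both masses to be replaced by their bound. *)
Lemma mixing_killed w lo hi z x : z \in B -> x \in B ->
  lo <= 0 <= hi -> (forall y, lo <= w y <= hi) ->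
  iter N (killed p G) w z - iter N (killed p G) w x <= (d + eta) * (hi - lo).
Proof.
move=> zB xB /andP[lo0 hi0] wb; rewrite !iter_killedE -sumrB.
pose D y := killed_pow p finset.set0 N z y - killed_pow p finset.set0 N x y.
pose a y := killed_pow p finset.set0 N z y - killed_pow p G N z y.
pose b y := killed_pow p finset.set0 N x y - killed_pow p G N x y.
have sumD : \sum_y D y = 0.
  by rewrite sumrB -!survivalE !survival_free // subrr.
have suma : \sum_y a y <= eta.
  rewrite sumrB -!survivalE survival_free //.
  by have := basin_survivalN zB; lra.
have sumb : \sum_y b y <= eta.
  rewrite sumrB -!survivalE survival_free //.
  by have := basin_survivalN xB; lra.
apply: (@le_trans _ _ (\sum_y ((2^-1 * (`|D y| + D y) + b y) * hi
                             - (2^-1 * (`|D y| - D y) + a y) * lo))).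
  apply: ler_sum => y _.
  have := killed_pow_le_free p_ge0 G N z y.
  have := killed_pow_le_free p_ge0 G N x y.
  have -> : killed_pow p G N z y * w y - killed_pow p G N x y * w y
     = (D y - a y + b y) * w y by rewrite /D /a /b; ring.
  rewrite -(subr_ge0 (killed_pow p G N x y)) -/(b y) => by0.
  rewrite -(subr_ge0 (killed_pow p G N z y)) -/(a y) => ay0.
  have /andP[low whi] := wb y.
  have n1 : D y <= `|D y| by rewrite ler_norm.
  have n2 : - D y <= `|D y| by rewrite -normrN ler_norm.
  set P := 2^-1 * (`|D y| + D y) + b y; set M := 2^-1 * (`|D y| - D y) + a y.
  have -> : D y - a y + b y = P - M by rewrite /P /M; field.
  have P0 : 0 <= P by rewrite /P; lra.
  have M0 : 0 <= M by rewrite /M; lra.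
  have : P * w y <= P * hi by rewrite ler_wpM2l.
  have : M * lo <= M * w y by rewrite ler_wpM2l.
  lra.
have sDp : \sum_y (`|D y| + D y) = \sum_y `|D y|.
  by rewrite big_split /= [X in _ + X]sumD addr0.
have sDm : \sum_y (`|D y| - D y) = \sum_y `|D y|.
  by rewrite sumrB [X in _ - X]sumD subr0.
rewrite sumrB -!mulr_suml.
rewrite [X in X * hi - _]big_split [X in _ - X * lo]big_split.
rewrite -!mulr_sumr sDp sDm /= -/(b _) -/(a _).
have mx : \sum_y `|D y| <= 2 * d := mixing zB xB.
rewrite mulrBr lerB //.
  by rewrite ler_wpM2r //; lra.
by rewrite ler_wnM2r //; lra.
Qed.

Variables (e u psi : S -> R).
Hypothesis eE : forall x, x \notin G -> e x = 1 + killed p G e x.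
Hypothesis uE : forall x, x \notin G -> u x = psi x + killed p G u x.
Hypothesis ue : forall x, 0 <= u x <= e x.
Hypothesis psi01 : forall x, 0 <= psi x <= 1.

Let e_ge0 x : 0 <= e x.
Proof. by have /andP[/le_trans h /h] := ue x. Qed.

(* Dominates the expected time before [B :|: G] is hit: by [recurrence] the whole
   series of survival probabilities is at most [(1 - r)^-1] times its first [N] terms. *)
Definition return_bound y : R := if y \in B :|: G then 0 else
  (1 - r)^-1 * \sum_(k < N) survival p (B :|: G) k y.

Let q_gt0 : 0 < (1 - r)^-1.
Proof. by rewrite invr_gt0 subr_gt0. Qed.

Lemma killed_split v y : killed p G v y =
  killed p (B :|: G) v y + \sum_(z in B) p y z * v z.
Proof.
rewrite /killed (bigID (fun z => z \in B)) /= addrC; congr (_ + _).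
  by apply: eq_bigl => z; rewrite !inE negb_or andbC.
by apply: eq_bigl => z; case: (boolP (z \in B)) => [/BG ->|]; rewrite ?andbF.
Qed.

(** The killed operator shifts the sum by one step, which costs [1 - survival N], at least [1 - r];
    the prefactor normalises this loss to at least 1. *)
Lemma return_bound_super y : y \notin B :|: G ->
  1 + killed p G return_bound y <= return_bound y.
Proof.
move=> yBG; rewrite killed_split [X in _ + (_ + X)]big1 ?addr0; last first.
  by move=> z zB; rewrite /return_bound inE zB mulr0.
have -> : killed p (B :|: G) return_bound y =
    (1 - r)^-1 * \sum_(k < N) survival p (B :|: G) k.+1 y.
  rewrite -[X in _ * X]killed_sum -killedZ; apply: eq_bigr => z /negbTE zBG.
  by rewrite /return_bound zBG.
rewrite /return_bound (negbTE yBG).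
have -> : \sum_(k < N) survival p (B :|: G) k y =
  1 - survival p (B :|: G) N y + \sum_(k < N) survival p (B :|: G) k.+1 y.
  case: {+}N N_gt0 => // n _; rewrite big_ord_recl big_ord_recr /=.
  by rewrite {1}/survival /=; ring.
rewrite mulrDr lerD2r ler_pdivlMl ?subr_gt0 //.
by rewrite mulr1; have := recurrence yBG; lra.
Qed.

Lemma return_bound_le y : return_bound y <= (1 - r)^-1 * N%:R.
Proof.
rewrite /return_bound; case: ifP => _; first by rewrite mulr_ge0 ?ler0n ?(ltW q_gt0).
rewrite ler_pM2l // -[N in leRHS]card_ord -sumr_const ler_sum // => k _.
exact: survival_le1.
Qed.

(** Steps into [B] contribute nonpositive terms, so [v] is also subharmonic for the chain killed on
    [B :|: G], to which the maximum principle applies. *)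
Lemma comparison v : (forall z, z \in B -> v z <= 0) ->
  (forall y, y \notin B :|: G -> v y <= killed p G v y) ->
  forall y, y \notin G -> v y <= 0.
Proof.
move=> vB vk y yG; case: (boolP (y \in B)) => [/vB //|yB].
have yBG : y \notin B :|: G by rewrite inE negb_or yB.
apply: (killed_max_principle p_ge0 r_lt1 recurrence) yBG => t tBG.
rewrite (le_trans (vk t tBG)) // killed_split gerDl.
by apply: sumr_le0 => z zB; rewrite mulr_ge0_le0 ?vB.
Qed.

(** [B :|: G] is reached in mean time at most [(1 - r)^-1 * N], after which at most [Estar] remains
    on average. *)
Lemma exit_time_le Estar y : (forall z, z \in B -> e z <= Estar) -> 0 <= Estar ->
  y \notin G -> e y <= Estar + (1 - r)^-1 * N%:R.
Proof.
move=> eB E0 yG; rewrite -subr_le0.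
apply: (@le_trans _ _ (e y - (Estar + return_bound y))).
  by rewrite lerD2l lerN2 lerD2l return_bound_le.
apply: (comparison (v := fun y => e y - (Estar + return_bound y))) yG.
  move=> z zB; rewrite /return_bound inE zB addr0 subr_le0; exact: eB.
move=> z zBG; have zG : z \notin G by move: zBG; rewrite inE negb_or => /andP[].
rewrite killedB killedD eE //.
have := return_bound_super zBG; have := killed_const_le p_ge0 p_sum1 G z E0.
lra.
Qed.

(** The difference of survivals is the probability of visiting [B] within [k] steps while avoiding
    [G]; at the first such visit, the mean remaining exit time is at least [emin]. *)
Lemma exit_time_ge emin y k : 0 <= emin ->
  (forall z, z \in B -> emin <= e z) -> y \notin G ->
  emin * (survival p G k y - survival p (B :|: G) k y) <= e y.
Proof.
move=> emin0 eB; elim: k y => [|k IHk] y yG; first by rewrite subrr mulr0.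
rewrite [leRHS]eE //; apply: (@le_trans _ _ (killed p G e y)); last lra.
rewrite /survival !iterS -!/(survival _ _ _).
rewrite !killed_split addrAC mulrDr lerD //.
  rewrite -killedB -killedZ killed_le // => z.
  by rewrite inE negb_or => /andP[_ zG]; rewrite IHk.
rewrite mulr_sumr; apply: ler_sum => z zB; rewrite mulrCA ler_wpM2l //.
by rewrite (le_trans _ (eB _ zB)) // ler_piMr // survival_le1.
Qed.

Lemma sum_survival_ge z : z \in B ->
  (1 - eta) * N%:R <= \sum_(k < N) survival p G k z.
Proof.
move=> zB; rewrite mulr_natr -[N in leLHS]card_ord -sumr_const ler_sum // => k _.
rewrite (le_trans (basin_survivalN zB)) // survival_anti //; exact: ltnW.
Qed.

Lemma basin_exit_time_ge z0 : z0 \in B -> (forall z, z \in B -> e z0 <= e z) ->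
  (1 - eta) * N%:R <= (r + eta) * e z0.
Proof.
move=> zB zmin; have e0 := e_ge0 z0.
(* The inner bound [e z0 * (survival N - r) <= e] holds at every state outside [G]; averaging it
   over the state reached after [N] steps composes two survivals into [survival (N + N)]. *)
have h : e z0 * (survival p G (N + N) z0 - r) <= iter N (killed p G) e z0.
  rewrite /survival iterD.
  apply: (@le_trans _ _ (iter N (killed p G)
     (fun y => e z0 * (survival p G N y - r)) z0)).
    rewrite !iter_killedE -/(survival p G N).
    under [leRHS]eq_bigr do rewrite mulrCA mulrBr.
    rewrite -mulr_sumr ler_wpM2l // sumrB lerD2l lerN2 -mulr_suml -survivalE.
    by rewrite ler_piMl // survival_le1.
  apply: iter_killed_le => // [y yG|]; last exact: BG.
  case: (boolP (y \in B)) => yB.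
    apply: (le_trans _ (zmin _ yB)); rewrite ler_piMr //.
    by have := survival_le1 p_ge0 p_sum1 G N y; move: r_ge0; lra.
  apply: le_trans (exit_time_ge N e0 zmin yG).
  rewrite ler_wpM2l // lerD2l lerN2 recurrence // inE negb_or yB //.
have := iter_expand N eE (BG zB); rewrite -/(survival p G _) => ez.
have h1 := sum_survival_ge zB.
have h2 : e z0 * (1 - eta - r) <= e z0 * (survival p G (N + N) z0 - r).
  by rewrite ler_wpM2l // lerD2r basin_survival.
have : (1 - eta) * N%:R + e z0 * (1 - eta - r) <= e z0.
  rewrite [leRHS]ez lerD //; exact: le_trans h2 h.
lra.
Qed.

Lemma basin_exit_time_diff M z x : z \in B -> x \in B ->
  (forall y, e y <= M) -> e z - e x <= N%:R + (d + eta) * M.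
Proof.
move=> zB xB eM.
have -> := iter_expand N eE (BG zB); have -> := iter_expand N eE (BG xB).
have M0 : 0 <= M by rewrite (le_trans (e_ge0 x)).
have h := @mixing_killed e 0 M z x zB xB _ _.
have {}h := h (introT andP (conj (lexx _) M0))
  (fun y => introT andP (conj (e_ge0 y) (eM y))).
have hz : \sum_(i < N) iter i (killed p G) (fun=> 1) z <= N%:R.
  rewrite -[N in leRHS]card_ord -sumr_const ler_sum // => k _.
  exact: survival_le1.
have hx : 0 <= \sum_(i < N) iter i (killed p G) (fun=> 1) x.
  by apply: sumr_ge0 => i _; apply: survival_ge0.
lra.
Qed.

(** [w] vanishes at [x] and takes values in an interval of width exactly [M], while [psi - lam]
    oscillates by at most 1 and so contributes at most [N] over [N] steps. Treating [u] and [e]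
    jointly avoids paying these errors twice. *)
Lemma occupation_le M x z : z \in B -> x \in B -> 0 < e x -> (forall y, e y <= M) ->
  u z - u x / e x * e z <= N%:R + (d + eta) * M.
Proof.
move=> zB xB ex0 eM; pose lam := u x / e x.
have /andP[ux0 uxe] := ue x.
have lam0 : 0 <= lam by rewrite divr_ge0.
have lam1 : lam <= 1 by rewrite ler_pdivrMr // mul1r.
have M0 : 0 <= M by rewrite (le_trans (e_ge0 x)).
pose w y := u y - lam * e y; pose phi y := psi y - lam.
have wx : w x = 0 by rewrite /w /lam divfK ?subrr // gt_eqF.
have wE y : y \notin G -> w y = phi y + killed p G w y.
  by move=> yG; rewrite /w /phi killedB killedZ uE // eE //; ring.
rewrite -/lam -/(w z) -[w z]subr0 -wx; clearbody lam.
have lam1' : 0 <= 1 - lam by rewrite subr_ge0.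
have -> := iter_expand N wE (BG zB); have -> := iter_expand N wE (BG xB).
have h := @mixing_killed w (- lam * M) ((1 - lam) * M) z x zB xB.
have {}h : iter N (killed p G) w z - iter N (killed p G) w x <= (d + eta) * M.
  have -> : M = (1 - lam) * M - - lam * M by ring.
  apply: h; first by rewrite mulNr oppr_le0 !mulr_ge0.
  move=> y; have /andP[uy0 uye] := ue y; rewrite /w.
  have : lam * e y <= lam * M by rewrite ler_wpM2l.
  have : (1 - lam) * e y <= (1 - lam) * M by rewrite ler_wpM2l //; lra.
  by move=> h1 h2; apply/andP; split; lra.
suff : \sum_(i < N) iter i (killed p G) phi z
       - \sum_(i < N) iter i (killed p G) phi x <= N%:R by lra.
have hz : \sum_(i < N) iter i (killed p G) phi z <= (1 - lam) * N%:R.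
  rewrite mulr_natr -[N in leRHS]card_ord -sumr_const ler_sum // => k _.
  rewrite iter_killedE.
  apply: (@le_trans _ _ (\sum_y killed_pow p G k z y * (1 - lam))).
    apply: ler_sum => y _; rewrite ler_wpM2l ?killed_pow_ge0 // /phi.
    by have /andP[] := psi01 y; lra.
  rewrite -mulr_suml -survivalE ler_piMl ?survival_le1 //; lra.
have hx : - (lam * N%:R) <= \sum_(i < N) iter i (killed p G) phi x.
  rewrite mulr_natr -[N in leLHS]card_ord -sumr_const -sumrN ler_sum // => k _.
  rewrite iter_killedE.
  apply: (@le_trans _ _ (\sum_y killed_pow p G k x y * - lam)).
    rewrite -mulr_suml -survivalE mulrN lerN2 ler_piMl ?survival_le1 //.
  apply: ler_sum => y _; rewrite ler_wpM2l ?killed_pow_ge0 // /phi.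
  by have /andP[] := psi01 y; lra.
lra.
Qed.

(* A positive functional since [pA] is sub-invariant for the killed chain. *)
Definition flux v : R := \sum_y pA y * (v y - killed p G v y).

Lemma fluxE v : flux v =
  \sum_(y | y \notin G) (pA y - \sum_x pA x * p x y) * v y.
Proof.
rewrite /flux.
under eq_bigr do rewrite mulrBr mulr_sumr.
rewrite sumrB exchange_big /=.
under [RHS]eq_bigr do rewrite mulrBl.
rewrite sumrB; congr (_ - _).
  rewrite (bigID (fun y => y \notin G)) /= [X in _ + X]big1 ?addr0 //.
  by move=> y; rewrite negbK => /pA_G ->; rewrite mul0r.
apply: eq_bigr => y _; rewrite mulr_suml; apply: eq_bigr => x _.
by rewrite mulrA.
Qed.

Lemma flux_le v w : (forall y, y \notin G -> v y <= w y) -> flux v <= flux w.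
Proof.
move=> vw; rewrite !fluxE; apply: ler_sum => y yG.
by rewrite ler_wpM2l ?vw // subr_ge0 pA_sub.
Qed.

(** Once survival outside [B :|: G] is enlarged to survival outside [G], the flux telescopes to the
    probability, from [pA], of hitting [G] within [N] steps. *)
Lemma flux_return_bound : (1 - r) * flux return_bound <= f.
Proof.
have q0 := q_gt0; have r1 : 0 < 1 - r by rewrite subr_gt0.
rewrite -ler_pdivlMl //.
apply: (@le_trans _ _ (flux (fun y => (1 - r)^-1 * \sum_(k < N) survival p G k y))).
  apply: flux_le => y yG; rewrite /return_bound; case: ifP => _.
    by rewrite mulr_ge0 ?sumr_ge0 ?ltW // => k _; apply: survival_ge0.
  rewrite ler_pM2l // ler_sum // => k _.
  move: (nat_of_ord k) => {}k; elim: k y yG => // k IHk y yG.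
  rewrite /survival !iterS -!/(survival _ _ _) killed_split.
  apply: (@le_trans _ _ (killed p (B :|: G) (survival p G k) y)).
    by apply: killed_le => // z; rewrite inE negb_or => /andP[_ zG]; apply: IHk.
  by rewrite lerDl sumr_ge0 // => z _; rewrite mulr_ge0 // survival_ge0.
rewrite /flux; under eq_bigr do rewrite killedZ -mulrBr mulrCA killed_sum.
rewrite -mulr_sumr ler_pM2l //.
have tel y : \sum_(k < N) survival p G k y
    - \sum_(k < N) killed p G (survival p G k) y = 1 - survival p G N y.
  rewrite -sumrB; elim: {+}N => [|n IHn]; first by rewrite big_ord0 subrr.
  have -> : survival p G n.+1 y = killed p G (survival p G n) y by [].
  by rewrite big_ord_recr IHn /=; ring.
under eq_bigr do rewrite tel mulrBr mulr1.
by rewrite sumrB pA_sum1; have := escape; lra.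
Qed.

Lemma quasi_ergodic x C emin : x \in B -> 0 < emin ->
  (forall z, z \in B -> emin <= e z) ->
  (forall z, z \in B -> u z - u x / e x * e z <= C) -> 0 <= C ->
  \sum_y pA y * psi y - u x / e x <= C / emin + f / (1 - r).
Proof.
move=> xB emin0 eB uC C0; pose lam := u x / e x.
pose w y := u y - lam * e y.
have -> : \sum_y pA y * psi y - lam = flux w.
  rewrite -[X in _ - X]mul1r -pA_sum1 mulr_suml -sumrB; apply: eq_bigr => y _.
  case: (boolP (y \in G)) => [/pA_G ->|yG]; first by rewrite !mul0r subrr.
  rewrite /w killedB killedZ (uE yG) (eE yG); ring.
have gam0 : 0 <= C / emin by rewrite divr_ge0 // ltW.
(* Each summand has its own task: on [B] the first one is at least [C]; outside [B] the unit source
   of [return_bound] absorbs [psi - lam <= 1]. *)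
apply: (@le_trans _ _ (flux (fun y => C / emin * e y + return_bound y))).
  apply: flux_le => y yG; rewrite -subr_le0.
  apply: (comparison (v := fun y => w y - (C / emin * e y + return_bound y))) yG.
    move=> z zB; rewrite /return_bound inE zB addr0 subr_le0.
    rewrite (le_trans (uC _ zB)) // mulrAC ler_pdivlMr // ler_wpM2l //.
    exact: eB.
  move=> z zBG; have zG : z \notin G by move: zBG; rewrite inE negb_or => /andP[].
  rewrite (killedB _ _ w) (killedD _ _ (fun y => C / emin * e y)).
  rewrite (killedZ _ _ _ e) [killed p G w z]killedB (killedZ _ _ _ e).
  rewrite /w (uE zG) (eE zG).
  have := return_bound_super zBG; have /andP[_ p1] := psi01 z.
  have : 0 <= lam by have /andP[u0 _] := ue x; rewrite divr_ge0.
  lra.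
have -> : flux (fun y => C / emin * e y + return_bound y)
    = C / emin * flux e + flux return_bound.
  rewrite /flux mulr_sumr -big_split /=; apply: eq_bigr => y _.
  by rewrite killedD killedZ; ring.
have -> : flux e = 1.
  rewrite -pA_sum1; apply: eq_bigr => y _.
  case: (boolP (y \in G)) => [/pA_G ->|yG]; first by rewrite !mul0r.
  by rewrite (eE yG) addrK mulr1.
rewrite mulr1 lerD2l ler_pdivlMr ?subr_gt0 //.
by rewrite mulrC flux_return_bound.
Qed.

Hypothesis e_G : forall x, x \in G -> e x = 0.

Lemma exit_time_gt0 z : z \notin G -> 0 < e z.
Proof.
move=> zG; rewrite eE // ltr_pwDl // killed_ge0 // => t _; exact: e_ge0.
Qed.

Lemma occupation_lln x : x \in B -> 0 <= f -> 0 <= d ->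
  \sum_y pA y * psi y - u x / e x <= 4 * (r + eta + f + eta / 2 + d).
Proof.
move=> xB f0 d0; have eta0 := eta_ge0; have r0 := r_ge0.
(* The left side never exceeds 1. When the right side is below 1, [r + eta] and [d + eta] are below
   1/4 and [eta] is below 1/6. *)
have [big1|small] := leP 1 (4 * (r + eta + f + eta / 2 + d)).
  apply: le_trans big1; rewrite -[leRHS]subr0 lerB //.
    rewrite -pA_sum1 ler_sum // => y _; rewrite ler_piMr //.
    by have /andP[] := psi01 y.
  by have /andP[u0 _] := ue x; rewrite divr_ge0.
have [z0 z0B z0min] := @arg_minP _ _ _ x (fun z => z \in B) e xB.
have [z1 z1B z1max] := @arg_maxP _ _ _ x (fun z => z \in B) e xB.
pose M := e z1 + (1 - r)^-1 * N%:R.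
have eM y : e y <= M.
  have [yG|yG] := boolP (y \in G); last exact: exit_time_le.
  by rewrite e_G // addr_ge0 // mulr_ge0 // ltW.
have M0 : 0 <= M := le_trans (e_ge0 x) (eM x).
have h1 := basin_exit_time_ge z0B z0min.
have h2 := basin_exit_time_diff z1B z0B eM.
have m0 := exit_time_gt0 (BG z0B).
have C0 : 0 <= N%:R + (d + eta) * M.
  by rewrite addr_ge0 // mulr_ge0 // addr_ge0.
have ex0 := exit_time_gt0 (BG xB).
have := quasi_ergodic xB m0 z0min
  (fun z zB => occupation_le zB xB ex0 eM) C0.
move=> /le_trans; apply.
have n0 : 0 <= (N%:R : R) by [].
have ME : M = e z1 + (1 - r)^-1 * N%:R by [].
clearbody M; set n : R := N%:R in h1 h2 C0 n0 ME *; set m := e z0 in h1 h2 m0 *.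
have r4 : r <= 4^-1 by lra.
have q : (1 - r)^-1 <= 4 / 3 by rewrite -[4 / 3]invrK lef_pV2 ?posrE //; lra.
(* From [eta < 1/6] one gets [(1 - eta)^-1 <= 6/5], and [6/5 * 1/4 = 3/10]. Then [hM] bounds [M] by
   itself with coefficient [d + eta < 1/4]; solving it gives [4/3 * (1 + 7/3 * 3/10) * m], that is
   [4/3 * 17/10 * m]. *)
have nm : n <= 3 / 10 * m by nra.
have nm' : n <= 6 / 5 * (r + eta) * m by nra.
have hM : M <= m + n + (d + eta) * M + 4 / 3 * n.
  by rewrite {1}ME; have := ler_wpM2r n0 q; lra.
have hM' : M <= 17 / 10 * (4 / 3) * m by nra.
have fr : f / (1 - r) <= 4 / 3 * f by rewrite mulrC ler_wpM2r.
suff : (n + (d + eta) * M) / m <= 6 / 5 * (r + eta) + (d + eta) * (17 / 10 * (4 / 3)).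
  lra.
have a0 : 0 <= d + eta by rewrite addr_ge0.
by rewrite ler_pdivrMr //; have := ler_wpM2l a0 hM'; lra.
Qed.

End quasi_ergodic_bound.

(** * Green function of the killed chain *)

Section green_function.
Variables (R : realType) (S : finType) (p : S -> S -> R) (G : {set S}).
Hypotheses (p_gt0 : forall x y, 0 < p x y) (p_sum1 : forall x, \sum_y p x y = 1).
Hypothesis G_neq0 : G != finset.set0.

Let p_ge0 x y : 0 <= p x y. Proof. exact: ltW. Qed.

Lemma survival_geometric :
  exists2 q : R, 0 <= q < 1 & forall k x, survival p G k x <= q ^+ k.
Proof.
have /set0Pn[g gG] := G_neq0.
(* [z] is the start from which a jump to [g] is least likely; every step is killed with at least
   that probability. *)
have [z _ zmin] := @arg_minP _ _ _ g xpredT (p ^~ g) isT.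
have le1 x y : p x y <= 1.
  by rewrite -(p_sum1 x) (bigD1 y) //= lerDl sumr_ge0.
exists (1 - p z g) => [|k x].
  by rewrite subr_ge0 le1 ltrBlDr ltrDl p_gt0.
elim: k x => [//|k IHk] x; rewrite exprS.
apply: (@le_trans _ _ (killed p G (fun=> (1 - p z g) ^+ k) x)).
  by apply: killed_le => // t _; apply: IHk.
rewrite /killed -mulr_suml ler_wpM2r ?exprn_ge0 ?subr_ge0 //.
rewrite -(p_sum1 x) [in leRHS](bigID (fun t => t \notin G)) /= -addrA lerDl subr_ge0.
rewrite (le_trans (zmin x isT)) // (bigD1 g) ?negbK //= lerDl sumr_ge0 //.
Qed.

Lemma killed_pow_le_survival k x y : killed_pow p G k x y <= survival p G k x.
Proof.
rewrite survivalE (bigD1 y) //= lerDl sumr_ge0 // => z _.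
exact: killed_pow_ge0.
Qed.

Definition green x y : R := limn (series (fun k => killed_pow p G k x y)).

Lemma is_cvg_green x y : cvgn (series (fun k => killed_pow p G k x y)).
Proof.
have [q /andP[q0 q1] hq] := survival_geometric.
apply: (@series_le_cvg _ _ (geometric 1 q)).
- by move=> k; apply: killed_pow_ge0.
- by move=> k; rewrite /geometric /= mul1r exprn_ge0.
- move=> k; rewrite /geometric /= mul1r.
  exact: le_trans (killed_pow_le_survival _ _ _) (hq _ _).
- by apply: is_cvg_geometric_series; rewrite ger0_norm.
Qed.

Lemma green_ge0 x y : 0 <= green x y.
Proof.
apply: limr_ge; first exact: is_cvg_green.
by apply: nearW => n; apply: sumr_ge0 => k _; apply: killed_pow_ge0.
Qed.

Lemma green_rec x y : green x y = (x == y)%:R + killed p G (green ^~ y) x.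
Proof.
have h1 : series (fun k => killed_pow p G k x y) n.+1 @[n --> \oo] --> green x y.
  by rewrite cvg_shiftS; apply: is_cvg_green.
have h2 : series (fun k => killed_pow p G k x y) n.+1 @[n --> \oo] -->
    (x == y)%:R + killed p G (green ^~ y) x.
  have -> : (fun n => series (fun k => killed_pow p G k x y) n.+1) =
     (fun n => (x == y)%:R + \sum_(z | z \notin G)
                  p x z * series (fun k => killed_pow p G k z y) n).
    apply/funext => n; rewrite /series /= big_nat_recl //; congr (_ + _).
    under [RHS]eq_bigr do rewrite mulr_sumr.
    by rewrite exchange_big.
  apply: cvgD; first exact: cvg_cst.
  apply: cvg_big => [|z _]; first exact: add_continuous.
  by apply: cvgMl_tmp; apply: is_cvg_green.
exact: (cvg_unique _ h1 h2).
Qed.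

End green_function.

(** The second conclusion keeps the mean exit time, a denominator, away from 0 as the mesh is
    refined. *)
Lemma green_lln (R : realType) (S : finType) (p : S -> S -> R) (G B : {set S})
    (pA psi : S -> R) (N : nat) (eta d f r : R) (x : S) :
  (forall x y, 0 < p x y) -> (forall x, \sum_y p x y = 1) ->
  G != finset.set0 -> (forall z, z \in B -> z \notin G) ->
  (forall y, 0 <= pA y) -> (forall y, y \in G -> pA y = 0) -> \sum_y pA y = 1 ->
  (forall y, y \notin G -> \sum_x pA x * p x y <= pA y) ->
  1 - f <= \sum_x pA x * survival p G N x ->
  (forall z, z \in B -> 1 - eta <= survival p G (N + N) z) ->
  (forall y, y \notin B :|: G -> survival p (B :|: G) N y <= r) ->
  (forall z x, z \in B -> x \in B -> \sum_y
    `|killed_pow p finset.set0 N z y - killed_pow p finset.set0 N x y| <= 2 * d) ->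
  (0 < N)%N -> 0 <= eta -> 0 <= r < 1 -> 0 <= f -> 0 <= d ->
  (forall y, 0 <= psi y <= 1) -> x \in B ->
  \sum_y pA y * psi y - (\sum_y green p G x y * psi y) / \sum_y green p G x y
    <= 4 * (r + eta + f + eta / 2 + d)
  /\ N%:R * (1 - eta) <= \sum_y green p G x y.
Proof.
move=> p_gt0 p_sum1 G0 BG pA_ge0 pA_G pA_sum1 pA_sub escape basin recur mixing.
move=> N0 eta0 /andP[r0 r1] f0 d0 psi01 xB.
have p_ge0 z y : 0 <= p z y by exact: ltW.
(* [green] counts time 0 even from a state of [G], whereas the exit time must vanish there. The
   equations outside [G] are unaffected, since [killed] does not see values on [G]. *)
pose F v z : R := if z \in G then 0 else \sum_y green p G z y * v y.
have FE v z : z \notin G -> F v z = v z + killed p G (F v) z.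
  move=> zG; rewrite {1}/F (negbTE zG).
  under eq_bigr do rewrite green_rec // mulrDl.
  rewrite big_split /=; congr (_ + _).
    rewrite (bigD1 z) //= eqxx mul1r big1 ?addr0 // => y.
    by rewrite eq_sym => /negbTE ->; rewrite mul0r.
  under eq_bigr do rewrite mulr_suml.
  rewrite exchange_big; apply: eq_bigr => t /negbTE tG; rewrite /F tG mulr_sumr.
  by apply: eq_bigr => y _; rewrite mulrA.
have F01 z : 0 <= F psi z <= F (fun=> 1) z.
  rewrite /F; case: ifP => _; first by rewrite lexx.
  apply/andP; split.
    by apply: sumr_ge0 => y _; rewrite mulr_ge0 ?green_ge0 //; case/andP: (psi01 y).
  by apply: ler_sum => y _; rewrite ler_wpM2l ?green_ge0 //; case/andP: (psi01 y).
have FG z : z \in G -> F (fun=> 1) z = 0 by move=> zG; rewrite /F zG.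
have xG := BG _ xB.
have Fx : F (fun=> 1) x = \sum_y green p G x y.
  by rewrite /F (negbTE xG); apply: eq_bigr => y _; rewrite mulr1.
have -> : \sum_y green p G x y * psi y = F psi x by rewrite /F (negbTE xG).
rewrite -Fx; split.
  exact: (occupation_lln p_ge0 p_sum1 BG pA_ge0 pA_G pA_sum1 pA_sub escape
    basin recur mixing N0 eta0 r0 r1 (FE (fun=> 1)) (FE psi) F01 psi01 FG).
rewrite (iter_expand N (FE (fun=> 1)) xG) mulrC.
have := sum_survival_ge p_ge0 p_sum1 basin xB.
rewrite /survival => /le_trans; apply; rewrite lerDl.
apply: iter_killed_ge0 => // z; have /andP[a b] := F01 z; exact: le_trans b.
Qed.

(** * Laws of the skeleton chains *)

Lemma measure_finType_union (d : measure_display) (T : measurableType d)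
    (R : realType) (mu : {measure set T -> \bar R}) (S : finType) (D : pred S)
    (F : S -> set T) :
  (forall s, measurable (F s)) -> trivIset setT F ->
  mu (\bigcup_(s in [set` D]) F s) = (\sum_(s | D s) mu (F s))%E.
Proof.
move=> mF tF; rewrite measure_fin_bigcup //.
- rewrite -(@bigfs _ _ _ _ (index_enum S)) ?index_enum_uniq //.
  by move=> s _; rewrite mem_index_enum.
- exact: sub_trivIset tF.
Qed.

Section chain.
Context {R : realType} {S : finType} {d : measure_display}
  {Omega : measurableType d}.
Variables (P : probability Omega R) (Q : S -> S -> R) (nu : S -> R).
Variable X : R -> Omega -> S.
Hypothesis hX : is_markov_chain P Q nu X.

Lemma measurable_state t (K : pred S) : 0 <= t -> measurable [set w | K (X t w)].
Proof.
move=> t0.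
have -> : [set w | K (X t w)] = \bigcup_(y in [set` K]) [set w | X t w = y].
  by apply/seteqP; split => w /= => [Kw|[y /= Ky ->]]; first by exists (X t w).
apply: fin_bigcup_measurable => [|y _]; first exact: finite_finset.
exact: (mc_measurable hX).
Qed.

(** The path is prescribed up to index [n] and only avoids [K] afterwards. The Markov property is
    given for prescribed paths, so the induction on [m] turns free steps into prescribed ones. *)
Definition path_event (h : R) (K : {set S}) (n m : nat) (z : nat -> S) (y : S) :=
  [set w | [/\ forall i, (i <= n)%N -> X (i%:R * h) w = z i,
     forall i, (n < i <= n + m)%N -> X (i%:R * h) w \notin K
     & X ((n + m)%:R * h) w = y]].

Lemma measurable_path_event h K n m z y : 0 <= h ->
  measurable (path_event h K n m z y).
Proof.
move=> h0.
have -> : path_event h K n m z y =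
   (\bigcap_(i in [set i | (i <= n)%N]) [set w | X (i%:R * h) w == z i])
   `&` (\bigcap_(i in [set i | (n < i <= n + m)%N]) [set w | X (i%:R * h) w \notin K])
   `&` [set w | X ((n + m)%:R * h) w == y].
  apply/seteqP; split => w /=.
    case=> h1 h2 h3; split; last exact/eqP.
    by split=> i /= hi; [apply/eqP/h1 | apply: h2].
  case=> [[h1 h2] /eqP h3]; split=> [i hi|i hi|//]; [exact/eqP/h1 | exact: h2].
have ih0 i : 0 <= i%:R * h by rewrite mulr_ge0.
apply: measurableI; last exact: (measurable_state (pred1 y)).
apply: measurableI; apply: bigcap_measurableType => i _.
  exact: (measurable_state (pred1 (z i))).
exact: (measurable_state (fun s => s \notin K)).
Qed.

Lemma prob_path_event h K n m z y : 0 <= h ->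
  P (path_event h K n m z y) =
  (nu (z 0%N) * \prod_(i < n) transition Q h (z i) (z i.+1)
    * killed_pow (transition Q h) K m (z n) y)%:E.
Proof.
move=> h0; elim: m n z => [|m IHm] n z.
  rewrite /killed_pow /=; have [zny|zny] := eqVneq (z n) y; last first.
    rewrite mulr0; have -> : path_event h K n 0 z y = set0; last exact: measure0.
    apply/seteqP; split => // w [h1 _]; rewrite addn0 h1 // => zy.
    by rewrite zy eqxx in zny.
  have -> : path_event h K n 0 z y =
      [set w | forall i, (i <= n)%N -> X (i%:R * h) w = z i].
    apply/seteqP; split => w /= => [[]//|h1]; split => //.
      by move=> i; rewrite addn0 => /andP[/leq_trans lt /lt]; rewrite ltnn.
    by rewrite addn0 h1.
  rewrite mulr1 (@mc_finite_dim _ _ _ _ _ _ _ _ hX n (fun i => i%:R * h)) //.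
  - congr (_ * _)%:E; apply: eq_bigr => i _; congr transition.
    by rewrite -natr1; ring.
  - by rewrite mul0r.
  - by move=> i; rewrite ler_wpM2r // ler_nat.
pose ext a i := if (i <= n)%N then z i else a.
have -> : path_event h K n m.+1 z y = \bigcup_(a in [set` [pred a | a \notin K]])
    path_event h K n.+1 m (ext a) y.
  apply/seteqP; split => w /=.
    case=> h1 h2 h3; exists (X (n.+1%:R * h) w) => /=.
      by apply: h2; rewrite ltnSn -addSnnS leq_addr.
    split; last by rewrite addSnnS.
      move=> i; rewrite leq_eqVlt => /orP[/eqP ->|]; first by rewrite /ext ltnn.
      by rewrite ltnS => hi; rewrite /ext hi h1.
    by move=> i; rewrite addSnnS => /andP[/ltnW a b]; apply: h2; rewrite a.
  case=> a /= aK [h1 h2 h3]; split.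
  - by move=> i hi; have := h1 i (leqW hi); rewrite /ext hi.
  - move=> i /andP[]; rewrite leq_eqVlt => /orP[/eqP <- _|a1 a2].
      by rewrite h1 // /ext ltnn.
    by apply: h2; rewrite a1 addSnnS.
  - by rewrite -addSnnS.
rewrite measure_finType_union; first last.
- move=> a b _ _ [w [[h1 _ _] [h2 _ _]]].
  by have := h1 n.+1 (leqnn _); rewrite h2 // /ext ltnn.
- by move=> a; apply: measurable_path_event.
rewrite (eq_bigr _ (fun a _ => IHm n.+1 (ext a))).
rewrite sumEFin; congr EFin.
rewrite [killed_pow]lock /killed_pow -lock iterS /killed mulr_sumr.
apply: eq_bigr => a _; rewrite big_ord_recr /=.
have -> : ext a 0 = z 0 by [].
have -> : ext a n = z n by rewrite /ext leqnn.
have -> : ext a n.+1 = a by rewrite /ext ltnn.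
rewrite -!mulrA; congr (_ * (_ * (_ * _))).
by apply: eq_bigr => i _; rewrite /ext (ltnW (ltn_ord i)) ltn_ord.
Qed.

End chain.

Section avoidance.
Context {R : realType} {S : finType} {d : measure_display}
  {Omega : measurableType d}.
Variables (P : probability Omega R) (Q : S -> S -> R) (nu : S -> R).
Variable X : R -> Omega -> S.
Hypothesis hX : is_markov_chain P Q nu X.

(** Time 0 is tested by [D] and not by [K], in accordance with [killed]. *)
Definition avoid_event (D : pred S) (h : R) (K : {set S}) (m : nat) (y : S) :=
  [set w | [/\ D (X 0 w), forall i, (0 < i <= m)%N -> X (i%:R * h) w \notin K
     & X (m%:R * h) w = y]].

Definition avoid_event_any (D : pred S) (h : R) (K : {set S}) (m : nat) :=
  [set w | D (X 0 w) /\ forall i, (0 < i <= m)%N -> X (i%:R * h) w \notin K].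

Lemma avoid_eventE D h K m y : avoid_event D h K m y =
  \bigcup_(a in [set` D]) path_event X h K 0 m (fun=> a) y.
Proof.
apply/seteqP; split => w /=.
  case=> h1 h2 h3; exists (X 0 w) => //=; split => //.
  by move=> i; rewrite leqn0 => /eqP ->; rewrite mul0r.
case=> a /= Da [h1 h2 h3]; split => //.
by have := h1 0%N (leqnn _); rewrite mul0r => ->.
Qed.

Lemma avoid_event_anyE D h K m : avoid_event_any D h K m =
  \bigcup_(y in [set` predT]) avoid_event D h K m y.
Proof.
apply/seteqP; split => w /=; first by case=> h1 h2; exists (X (m%:R * h) w).
by case=> y _ [h1 h2 h3]; split.
Qed.

Lemma measurable_avoid_event D h K m y : 0 <= h ->
  measurable (avoid_event D h K m y).
Proof.
move=> h0; rewrite avoid_eventE; apply: fin_bigcup_measurable => [|a _].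
  exact: finite_finset.
exact: (measurable_path_event hX).
Qed.

Lemma measurable_avoid_event_any D h K m : 0 <= h ->
  measurable (avoid_event_any D h K m).
Proof.
move=> h0; rewrite avoid_event_anyE; apply: fin_bigcup_measurable => [|a _].
  exact: finite_finset.
exact: measurable_avoid_event.
Qed.

Lemma prob_avoid_event D h K m y : 0 <= h ->
  P (avoid_event D h K m y) =
  (\sum_(a | D a) nu a * killed_pow (transition Q h) K m a y)%:E.
Proof.
move=> h0; rewrite avoid_eventE measure_finType_union; first last.
- move=> a b _ _ [w [[h1 _ _] [h2 _ _]]].
  by have := h1 0%N (leqnn _); rewrite h2.
- by move=> a; apply: (measurable_path_event hX).
rewrite -sumEFin; apply: eq_bigr => a _.
by rewrite [LHS](prob_path_event hX) // big_ord0 mulr1.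
Qed.

Lemma prob_avoid_event_any D h K m : 0 <= h ->
  P (avoid_event_any D h K m) =
  (\sum_(a | D a) nu a * survival (transition Q h) K m a)%:E.
Proof.
move=> h0; rewrite avoid_event_anyE measure_finType_union; first last.
- by move=> a b _ _ [w [[_ _ <-] [_ _ <-]]].
- by move=> a; apply: measurable_avoid_event.
rewrite (eq_bigr _ (fun y _ => prob_avoid_event D K m y h0)) sumEFin.
rewrite exchange_big; congr EFin; apply: eq_bigr => a _.
by rewrite survivalE mulr_sumr.
Qed.

End avoidance.

(** * The transition function as a stochastic semigroup *)

Section transition_function.
Context {R : realType} {S : finType} {d : measure_display}
  {Omega : measurableType d}.
Variables (P : probability Omega R) (Q : S -> S -> R).
Variable X : (S -> R) -> R -> Omega -> S.
Hypothesis hX : is_markov_family P Q X.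

Lemma is_prob_point_law (x : S) : is_prob (point_law x : S -> R).
Proof.
split=> [y|]; first exact: ler0n.
by rewrite (bigD1 x) //= /point_law eqxx big1 ?addr0 // => y /negbTE ->.
Qed.

Lemma sum_point_law (x : S) (u : S -> R) (D : pred S) : D x ->
  \sum_(a | D a) point_law x a * u a = u x.
Proof.
move=> Dx; rewrite (bigD1 x) //= /point_law eqxx mul1r big1 ?addr0 // => y.
by move=> /andP[_ /negbTE ->]; rewrite mul0r.
Qed.

Lemma law_transition t x y : 0 <= t ->
  P [set w | X (point_law x) t w = y] = (transition Q t x y)%:E.
Proof.
move=> t0; have hx := hX (is_prob_point_law x).
transitivity (P (avoid_event (X (point_law x)) predT t finset.set0 1 y)).
  congr (P _); apply/seteqP; split => w /=.
    by move=> Xy; split; rewrite ?mul1r // => i _; rewrite inE.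
  by case=> _ _; rewrite mul1r.
rewrite (prob_avoid_event hx) // (sum_point_law _ (D := predT)) //.
rewrite /killed_pow /= /killed (bigD1 y) ?inE //= eqxx mulr1 big1 ?addr0 // => z.
by move=> /andP[_ /negbTE ->]; rewrite mulr0.
Qed.

(** Nonnegativity and, below, unit row sums are read off the law of the chain rather than off the
    exponential series. *)
Lemma transition_ge0 t x y : 0 <= t -> 0 <= transition Q t x y.
Proof. by move=> t0; rewrite -lee_fin -(law_transition _ _ t0). Qed.

Lemma transition_sum1 t x : 0 <= t -> \sum_y transition Q t x y = 1.
Proof.
move=> t0; have hx := hX (is_prob_point_law x).
apply/EFin_inj; rewrite -sumEFin -(eq_bigr _ (fun y _ => law_transition x y t0)).
rewrite -(measure_finType_union _ predT) => [|y|].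
- rewrite -[RHS](probability_setT P); congr (P _).
  by apply/seteqP; split => w //= _; exists (X (point_law x) t w).
- exact: (mc_measurable hx).
- by move=> a b _ _ [w [/= <- <-]].
Qed.

(** Chapman-Kolmogorov: both sides are the law of the chain at time [m%:R * h]. *)
Lemma transition_iter h m x y : 0 <= h ->
  killed_pow (transition Q h) finset.set0 m x y = transition Q (m%:R * h) x y.
Proof.
move=> h0; have hx := hX (is_prob_point_law x); apply/EFin_inj.
rewrite -law_transition ?mulr_ge0 //.
transitivity (P (avoid_event (X (point_law x)) predT h finset.set0 m y)).
  by rewrite (prob_avoid_event hx) // (sum_point_law _ (D := predT)).
congr (P _); apply/seteqP; split => w /=; first by case.
by move=> Xy; split => // i _; rewrite inE.
Qed.

End transition_function.

(** * Positivity and invariance of the transition function *)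

Section exponential_series.
Context {R : realType} {S : finType}.
Variable Q : S -> S -> R.

Definition rate_bound : R := \sum_x \sum_y `|Q x y|.

Lemma rate_bound_ge0 : 0 <= rate_bound.
Proof. by apply: sumr_ge0 => x _; apply: sumr_ge0. Qed.

Lemma rate_pow_le k x y : `|rate_pow Q k x y| <= rate_bound ^+ k.
Proof.
elim: k x y => [|k IHk] x y /=; first by case: (x == y); rewrite ?normr1 ?normr0.
rewrite (le_trans (ler_norm_sum _ _ _)) // exprS.
apply: (@le_trans _ _ (\sum_z `|Q x z| * rate_bound ^+ k)).
  by apply: ler_sum => z _; rewrite normrM ler_wpM2l.
rewrite -mulr_suml ler_wpM2r ?exprn_ge0 ?rate_bound_ge0 //.
rewrite /rate_bound [leRHS](bigD1 x) //= lerDl.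
by apply: sumr_ge0 => z _; apply: sumr_ge0.
Qed.

Lemma exp_term_le t k x y :
  `|exp_coeff t k * rate_pow Q k x y| <= exp_coeff (`|t| * rate_bound) k.
Proof.
rewrite normrM !exp_coeffE normrM normrX ger0_norm ?invr_ge0 // exprMn mulrA.
by rewrite ler_wpM2l ?rate_pow_le // mulr_ge0 ?invr_ge0 ?exprn_ge0.
Qed.

Lemma is_cvg_transition t x y :
  cvgn (series (fun k => exp_coeff t k * rate_pow Q k x y)).
Proof.
apply: normed_cvg; apply: (@series_le_cvg _ _ (exp_coeff (`|t| * rate_bound))).
- by move=> k; rewrite normr_ge0.
- by move=> k; rewrite exp_coeff_ge0 // mulr_ge0 ?rate_bound_ge0.
- by move=> k; exact: exp_term_le.
- exact: is_cvg_series_exp_coeff.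
Qed.

(** As [t <= 1], each term of order k >= 2 is at most [t ^+ 2] times the corresponding term of the
    series of [expR rate_bound]. *)
Lemma transition_ge_linear t x y : 0 <= t <= 1 ->
  (x == y)%:R + t * Q x y - t ^+ 2 * expR rate_bound <= transition Q t x y.
Proof.
move=> /andP[t0 t1]; apply: limr_ge; first exact: is_cvg_transition.
near=> n; have n2 : (2 <= n)%N by near: n; exact: nbhs_infty_ge.
rewrite -(subnK n2) addn2; move: (n - 2)%N => {n2}m.
rewrite /series /= big_nat_recl // big_nat_recl // -addrA addrA.
have -> : exp_coeff t 0 * rate_pow Q 0 x y = (x == y)%:R.
  by rewrite exp_coeffE /= fact0 invr1 !mul1r.
have -> : exp_coeff t 1 * rate_pow Q 1 x y = t * Q x y.
  rewrite exp_coeffE /= expr1 (_ : 1`! = 1%N) // invr1 mul1r.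
  rewrite (bigD1 y) //= eqxx mulr1 big1 ?addr0 //.
  by move=> z /negbTE ->; rewrite mulr0.
rewrite -addrA lerD2l; rewrite lerD2l lerNl -sumrN.
have C0 := rate_bound_ge0.
apply: (@le_trans _ _ (t ^+ 2 * series (exp_coeff rate_bound) m.+2)); last first.
  rewrite ler_wpM2l ?exprn_ge0 //; apply: nondecreasing_cvgn_le.
    by apply: nondecreasing_series => k _ _; rewrite exp_coeff_ge0.
  exact: is_cvg_series_exp_coeff.
rewrite /series /= big_nat_recl // big_nat_recl // addrA mulrDr mulr_sumr.
rewrite ler_wpDl ?mulr_ge0 ?exprn_ge0 ?addr_ge0 ?exp_coeff_ge0 //.
apply: ler_sum => k _; rewrite (le_trans (ler_norm _)) // normrN.
rewrite (le_trans (exp_term_le _ _ _ _)) // ger0_norm // !exp_coeffE exprMn [leLHS]mulrCA.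
have Ck : 0 <= rate_bound ^+ k.+2 by exact: exprn_ge0.
by rewrite ler_wpM2r ?ler_wiXn2l // mulr_ge0 // invr_ge0.
Unshelve. all: by end_near. Qed.

(** [pi] annihilates every positive power of [Q], so only the identity term of the series
    remains. *)
Lemma transition_invariant pi t y : invariant_prob Q pi ->
  \sum_x pi x * transition Q t x y = pi y.
Proof.
move=> [_ piQ].
have piQk k : \sum_x pi x * rate_pow Q k.+1 x y = 0.
  rewrite /=; under eq_bigr do rewrite mulr_sumr.
  rewrite exchange_big /= big1 // => z _.
  under eq_bigr do rewrite mulrA.
  by rewrite -mulr_suml piQ mul0r.
pose u n := \sum_x pi x * series (fun k => exp_coeff t k * rate_pow Q k x y) n.
have h1 : u n @[n --> \oo] --> \sum_x pi x * transition Q t x y.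
  apply: cvg_big => [|x _]; first exact: add_continuous.
  by apply: cvgMl_tmp; apply: is_cvg_transition.
have h2 : u n @[n --> \oo] --> pi y.
  rewrite -cvg_shiftS; have -> : (fun n => u n.+1) = cst (pi y); last exact: cvg_cst.
  apply/funext => n; rewrite /u /series /= /cst.
  under eq_bigr do rewrite mulr_sumr.
  rewrite exchange_big /= big_nat_recl // [X in _ + X]big1 ?addr0.
    rewrite (bigD1 y) //= big1 ?addr0 => [|x /negbTE -> /=].
      by rewrite eqxx mulr1 exp_coeffE /= fact0 invr1 !mul1r mulr1.
    by rewrite !mulr0.
  move=> k _; under eq_bigr do rewrite mulrCA.
  by rewrite -mulr_sumr piQk mulr0.
exact: (cvg_unique _ h1 h2).
Qed.

End exponential_series.

Section positivity.
Context {R : realType} {S : finType} {d : measure_display}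
  {Omega : measurableType d}.
Variables (P : probability Omega R) (Q : S -> S -> R).
Variable X : (S -> R) -> R -> Omega -> S.
Hypotheses (hX : is_markov_family P Q X) (hirr : irreducible_rates Q).

Lemma transition_small_gt0 : \forall t \near 0^'+, forall x y : S,
  (x == y) || (0 < Q x y) -> 0 < transition Q t x y.
Proof.
apply: filter_forall => x; apply: filter_forall => y.
have a0 : 0 < expR (rate_bound Q) by exact: expR_gt0.
have b0 : 0 < `|Q x y| + expR (rate_bound Q) by rewrite ltr_wpDl.
have [eq_xy|xy] /= := eqVneq x y.
  near=> t => _; have t0 : 0 < t by near: t; exact: nbhs_right_gt.
  have t1 : t <= 1 by near: t; apply: nbhs_right_le.
  apply: lt_le_trans (transition_ge_linear Q x y (t := t) _); last by rewrite ltW.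
  have ht : t * (`|Q x y| + expR (rate_bound Q)) < 1.
    rewrite -ltr_pdivlMr //.
    by near: t; apply: nbhs_right_lt; rewrite divr_gt0.
  have h1 : - `|Q x y| <= Q x y by rewrite lerNl -normrN ler_norm.
  have : t * - `|Q x y| <= t * Q x y by rewrite ler_wpM2l // ltW.
  have : t ^+ 2 * expR (rate_bound Q) <= t * expR (rate_bound Q).
    by rewrite ler_wpM2r ?(ltW a0) // expr2 ler_piMl // ltW.
  have -> : (x == y)%:R = 1 :> R by rewrite eq_xy eqxx.
  lra.
have [Qxy|_] := boolP (0 < Q x y); last by apply: nearW.
near=> t => _; have t0 : 0 < t by near: t; exact: nbhs_right_gt.
have t1 : t <= 1 by near: t; apply: nbhs_right_le.
apply: lt_le_trans (transition_ge_linear Q x y (t := t) _); last by rewrite ltW.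
rewrite (negbTE xy) add0r expr2 -mulrA -mulrBr mulr_gt0 //.
rewrite subr_gt0 -ltr_pdivlMr //.
by near: t; apply: nbhs_right_lt; rewrite divr_gt0.
Unshelve. all: by end_near. Qed.

Lemma transition_gt0 t x y : 0 < t -> 0 < transition Q t x y.
Proof.
move=> t0; have /connectP[s xs ->] := hirr x y.
have [e /= e0 he] := transition_small_gt0.
(* At least one step per edge of the path, and enough of them to bring the step [t / m] below
   [e]. *)
pose m := maxn (size s) (Num.truncn (t / e)).+1.
have m0 : 0 < m%:R :> R by rewrite ltr0n (leq_trans _ (leq_maxr _ _)).
have h0 : 0 < t / m%:R by rewrite divr_gt0.
have he' a b : (a == b) || (0 < Q a b) -> 0 < transition Q (t / m%:R) a b.
  apply: he => //=; rewrite sub0r normrN gtr0_norm //.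
  rewrite ltr_pdivrMr // mulrC -ltr_pdivrMr //.
  rewrite (lt_le_trans (truncnS_gt _)) // ler_nat leq_maxr //.
have -> : t = m%:R * (t / m%:R) by rewrite mulrCA divff ?mulr1 // gt_eqF.
rewrite -(transition_iter hX) ?ltW //.
have p_ge0 a b : 0 <= transition Q (t / m%:R) a b by rewrite (transition_ge0 hX) // ltW.
have : (size s <= m)%N by exact: leq_maxl.
clearbody m.
move: (transition Q _) p_ge0 he' => p p_ge0 p_gt0.
elim: {t0 m0 h0}m s x xs => [|m IHm] [|b s] a //=; first by rewrite /killed_pow /= eqxx.
  (* Once the path is exhausted, the surplus steps are spent at its end. *)
  move=> _ _; apply: (@lt_le_trans _ _ (p a a * killed_pow p finset.set0 m a a)).
    by rewrite mulr_gt0 ?p_gt0 ?eqxx // (IHm [::]).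
  rewrite [leRHS](bigD1 a) ?inE //= lerDl sumr_ge0 // => z _.
  by rewrite mulr_ge0 // iter_killed_ge0.
move=> /andP[ab bs]; rewrite ltnS => sm.
apply: (@lt_le_trans _ _ (p a b * killed_pow p finset.set0 m b (last b s))).
  by rewrite mulr_gt0 ?p_gt0 ?ab ?orbT // IHm.
rewrite [leRHS](bigD1 b) ?inE //= lerDl sumr_ge0 // => z _.
by rewrite mulr_ge0 // iter_killed_ge0.
Qed.

Lemma invariant_gt0 pi x : invariant_prob Q pi -> 0 < pi x.
Proof.
move=> hpi; have [[pi0 pi1] _] := hpi.
have [z piz] : exists z, 0 < pi z.
  apply/not_existsP => npi; have : \sum_x pi x = 0.
    apply: big1 => z _; apply/eqP; rewrite eq_le pi0 andbT leNgt.
    exact/negP/npi.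
  by rewrite pi1 => /eqP; rewrite oner_eq0.
rewrite -(transition_invariant 1 x hpi) (bigD1 z) //= ltr_pwDl //.
  by rewrite mulr_gt0 // transition_gt0.
by apply: sumr_ge0 => a _; rewrite mulr_ge0 // (transition_ge0 hX).
Qed.

End positivity.

(** * Hitting times and occupation times *)

Section dyadic_mesh.
Context {R : realType}.

Lemma near_mesh_lt (t e : R) : 0 < t -> 0 < e ->
  exists N, forall n, (N <= n)%N -> t / 2 ^+ n < e.
Proof.
move=> t0 e0; have q1 : `|2^-1 : R| < 1 by rewrite ger0_norm //; lra.
have /cvgrPdist_lt/(_ e e0)[N _ hN] := cvg_geometric t q1.
exists N => n Nn; have := hN n Nn.
by rewrite sub0r normrN /geometric /= exprVn ger0_norm // divr_ge0 ?exprn_ge0 // ltW.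
Qed.

Lemma mesh_gt0 (t : R) n : 0 < t -> 0 < t / 2 ^+ n.
Proof. by move=> t0; rewrite divr_gt0 ?exprn_gt0. Qed.

Lemma truncn_mesh (s h : R) k : 0 < h -> 0 <= s ->
  (k%:R * h <= s < k.+1%:R * h) = (Num.truncn (s / h) == k).
Proof.
move=> h0 s0; rewrite -ler_pdivlMr // -ltr_pdivrMr //.
apply/idP/eqP => [/truncn_def //|<-].
by apply: truncn_itv; rewrite divr_ge0 // ltW.
Qed.

Lemma truncn_mesh_itv (s h : R) : 0 < h -> 0 <= s ->
  (Num.truncn (s / h))%:R * h <= s < (Num.truncn (s / h)).+1%:R * h.
Proof. by move=> h0 s0; rewrite truncn_mesh. Qed.

Lemma truncn_mesh_next (s h : R) : 0 < h -> 0 <= s ->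
  s < (Num.truncn (s / h)).+1%:R * h <= s + h.
Proof.
move=> h0 s0; have /andP[a b] := truncn_mesh_itv h0 s0.
by rewrite b /= -natr1 mulrDl mul1r lerD2r.
Qed.

End dyadic_mesh.

Section hitting.
Context {R : realType} {S : finType} {d : measure_display}
  {Omega : measurableType d}.
Variables (P : probability Omega R) (Q : S -> S -> R) (nu : S -> R).
Variable X : R -> Omega -> S.
Hypothesis hX : is_markov_chain P Q nu X.

Lemma hit_le (K : {set S}) w s : 0 <= s -> X s w \in K -> (hit X K w <= s%:E)%E.
Proof. by move=> s0 Xs; apply: ereal_inf_lbound; exists s. Qed.

Lemma hit_ge0 (K : {set S}) w : (0 <= hit X K w)%E.
Proof. by apply: le_ereal_inf_tmp => _ [s [s0 _] <-]; rewrite lee_fin. Qed.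

Variant hit_spec (K : {set S}) w : \bar R -> Prop :=
| HitNever of (forall s, 0 <= s -> X s w \notin K) : hit_spec K w +oo%E
| HitAt tau of 0 <= tau & X tau w \in K
    & (forall s, 0 <= s < tau -> X s w \notin K) : hit_spec K w tau%:E.

(* By right-continuity the infimum defining [hit] is attained. *)
Lemma hitP (K : {set S}) w : hit_spec K w (hit X K w).
Proof.
have h0 := hit_ge0 K w.
case eq_hit : (hit X K w) h0 => [tau| |] // h0.
  have tau0 : 0 <= tau by rewrite -lee_fin.
  have before s : 0 <= s < tau -> X s w \notin K.
    move=> /andP[s0 st]; apply/negP => /(hit_le s0).
    by rewrite eq_hit lee_fin leNgt st.
  apply: HitAt => //; have [e e0 he] := mc_right_continuous hX w tau0.
  have fh : hit X K w \is a fin_num by rewrite eq_hit.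
  have [_ [s [s0 Xs] <-]] := lb_ereal_inf_adherent e0 fh.
  rewrite -/(hit X K w) eq_hit -EFinD lte_fin => se.
  rewrite -(he s) // se andbT leNgt; apply/negP => st.
  by have := before s; rewrite s0 st Xs => /(_ isT).
apply: HitNever => s s0; apply/negP => /(hit_le s0).
by rewrite eq_hit.
Qed.

(** Were [K] hit at [tau <= t], the path would keep its state on some [[tau, tau + e)], and a mesh
    finer than [e] has a point there. *)
Lemma lt_hit_dyadic (K : {set S}) t w : 0 < t ->
  (forall n, avoid_event_any X (fun a => a \notin K) (t / 2 ^+ n) K (2 ^ n) w) ->
  (t%:E < hit X K w)%E.
Proof.
move=> t0 avoid; rewrite ltNge; apply/negP.
case: hitP => // tau tau0 Xtau before; rewrite lee_fin => taut.
have [e e0 he] := mc_right_continuous hX w tau0.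
have [N hN] := near_mesh_lt t0 e0; have {hN} he' := hN N (leqnn _).
have [X0 Xi] := avoid N; set h := t / 2 ^+ N in he' Xi.
have h0 : 0 < h := mesh_gt0 N t0.
have tE : (2 ^ N)%:R * h = t.
  by rewrite natrX /h mulrCA divff ?mulr1 // gt_eqF // exprn_gt0.
(* The next mesh point after [t] would leave the horizon, but [t] is itself the last mesh point. *)
have [tau_eq|tau_ne] := eqVneq tau t.
  have := Xi (2 ^ N)%N; rewrite tE -tau_eq Xtau expn_gt0 leqnn.
  by move=> /(_ isT).
have {tau_ne}taut : tau < t by rewrite lt_neqAle tau_ne.
have /andP[lo hi] := truncn_mesh_next h0 tau0.
have k2 : (0 < (Num.truncn (tau / h)).+1 <= 2 ^ N)%N.
  rewrite /= truncn_lt_nat.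
  by rewrite ltr_pdivrMr // tE.
  by rewrite divr_ge0 // ltW.
have := Xi _ k2; rewrite he ?Xtau //.
by rewrite ltW //= (le_lt_trans hi) // ltrD2l.
Qed.

Lemma lt_hit_avoid (K : {set S}) t m h w : 0 <= h -> m%:R * h <= t ->
  (t%:E < hit X K w)%E -> avoid_event_any X predT h K m w.
Proof.
move=> h0 mht; case: hitP => [never _|tau tau0 _ before].
  by split => // i _; rewrite never // mulr_ge0.
rewrite lte_fin => ttau; split => // i /andP[_ im]; rewrite before // mulr_ge0 //=.
by rewrite (le_lt_trans _ ttau) // (le_trans _ mht) // ler_wpM2r // ler_nat.
Qed.

Lemma lt_hitE (K : {set S}) t : 0 < t ->
  [set w | (t%:E < hit X K w)%E] = \bigcap_n
    avoid_event_any X (fun a => a \notin K) (t / 2 ^+ n) K (2 ^ n).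
Proof.
move=> t0; apply/seteqP; split => w /=; last first.
  by move=> h; apply: lt_hit_dyadic => // n; apply: h.
move=> tw n _; split.
  move: tw; case: hitP => [-> //|tau tau0 _ before]; rewrite lte_fin => ttau.
  by rewrite before // lexx (lt_trans t0).
apply: (lt_hit_avoid _ _ tw).2; first exact/ltW/mesh_gt0.
by rewrite natrX mulrCA divff ?mulr1 // gt_eqF // exprn_gt0.
Qed.

Lemma measurable_lt_hit (K : {set S}) t : 0 < t ->
  measurable [set w | (t%:E < hit X K w)%E].
Proof.
move=> t0; rewrite lt_hitE //; apply: bigcap_measurableType => n _.
by apply: (measurable_avoid_event_any hX); rewrite ltW ?mesh_gt0.
Qed.

Lemma measurable_hit_le (K : {set S}) t : 0 < t ->
  measurable [set w | (hit X K w <= t%:E)%E].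
Proof.
move=> t0; rewrite (_ : mkset _ = ~` [set w | (t%:E < hit X K w)%E]).
  by apply: measurableC; apply: measurable_lt_hit.
by apply/seteqP; split => w /=; rewrite leNgt; [move/negP | move=> h; apply/negP].
Qed.

(** A visit at a mesh time is a genuine visit, so the bound holds without any limit. *)
Lemma prob_hit_le_ge (K : {set S}) m h t : 0 < t -> 0 <= h -> m%:R * h <= t ->
  1 - \sum_a nu a * survival (transition Q h) K m a <= prob_hit_le P X K t.
Proof.
move=> t0 h0 mht; rewrite /prob_hit_le.
rewrite -lee_fin fineK; last by rewrite fin_num_measure //; apply: measurable_hit_le.
rewrite EFinB.
have -> : (\sum_a nu a * survival (transition Q h) K m a)%:E =
    P (avoid_event_any X predT h K m) by rewrite (prob_avoid_event_any hX).
rewrite -probability_setC; last exact: (measurable_avoid_event_any hX).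
apply: le_measure; rewrite ?inE.
- exact/measurableC/(measurable_avoid_event_any hX).
- exact: measurable_hit_le.
move=> w /= nav; rewrite leNgt; apply/negP => /(lt_hit_avoid h0 mht) //.
Qed.

(** Dyadic meshes are nested, so the avoidance events decrease, and by right-continuity their
    intersection is [t < hit]. *)
Lemma cvg_prob_hit_gt (K : {set S}) t : 0 < t ->
  \sum_(a | a \notin K) nu a * survival (transition Q (t / 2 ^+ n)) K (2 ^ n) a
    @[n --> \oo] --> prob_hit_gt P X K t.
Proof.
move=> t0; rewrite /prob_hit_gt lt_hitE //.
pose F n := avoid_event_any X (fun a => a \notin K) (t / 2 ^+ n) K (2 ^ n).
have mF n : measurable (F n).
  by apply: (measurable_avoid_event_any hX); rewrite ltW ?mesh_gt0.
have decrF : {homo F : n m / (n <= m)%N >-> (m <= n)%O}.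
  apply/nonincreasing_seqP => n; apply/subsetPset => w [w0 hw]; split => // i /andP[i0 i2].
  have := hw i.*2; rewrite double_gt0 i0 -muln2 expnSr leq_mul2r i2 => /(_ isT).
  suff -> : (i * 2)%:R * (t / 2 ^+ n.+1) = i%:R * (t / 2 ^+ n) by [].
  by rewrite natrM exprSr; field; rewrite expf_neq0.
have h : (P \o F) n @[n --> \oo] --> P (\bigcap_n F n).
  apply: nonincreasing_cvg_mu => //.
    by rewrite ltey_eq fin_num_measure.
  by apply: bigcap_measurableType.
have fE : P (\bigcap_n F n) = (fine (P (\bigcap_n F n)))%:E.
  by rewrite fineK // fin_num_measure //; apply: bigcap_measurableType.
rewrite fE in h; have {}h := fine_cvg h.
suff <- : fine \o (P \o F) = (fun n : nat => \sum_(a | a \notin K)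
    nu a * survival (transition Q (t / 2 ^+ n)) K (2 ^ n) a) by exact: h.
apply/funext => n /=.
by rewrite (prob_avoid_event_any hX) // ltW // mesh_gt0.
Qed.

End hitting.

(** * Events that are constant over mesh cells, under the product of [P] and Lebesgue measure *)

Section grid.
Context {R : realType} {d : measure_display} {Omega : measurableType d}.
Variable P : probability Omega R.

Definition grid (h : R) (E : nat -> set Omega) : set (Omega * measurableTypeR R) :=
  \bigcup_k (E k `*` `[k%:R * h, k.+1%:R * h[%classic).

Lemma gridE h E w (s : R) : 0 < h ->
  grid h E (w, s) <-> 0 <= s /\ E (Num.truncn (s / h)) w.
Proof.
move=> h0; split=> [[k _ [/= Ew]]|[s0 Ew]].
  rewrite in_itv /= => ks; have s0 : 0 <= s.
    by have /andP[+ _] := ks; apply: le_trans; rewrite mulr_ge0 // ltW.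
  by move: ks; rewrite truncn_mesh // => /eqP ->.
by exists (Num.truncn (s / h)) => //; split=> //=; rewrite in_itv /= truncn_mesh_itv.
Qed.

Lemma measurable_grid h E : (forall k, measurable (E k)) -> measurable (grid h E).
Proof.
move=> mE; apply: bigcup_measurable => k _.
by apply: measurableX => //; apply: measurable_itv.
Qed.

Lemma measure_grid h E (u : nat -> R) l : 0 < h -> (forall k, measurable (E k)) ->
  (forall k, P (E k) = (u k)%:E) -> series u @ \oo --> l ->
  (P \x (@lebesgue_measure R))%E (grid h E) = (h * l)%:E.
Proof.
move=> h0 mE PE ul; rewrite /grid measure_bigcup; first last.
- move=> i j _ _ [[w s] [/= [_ /= si] [_ /= sj]]].
  move: si sj; rewrite !in_itv /= => si sj.
  have s0 : 0 <= s.
    by have /andP[+ _] := si; apply: le_trans; rewrite mulr_ge0 // ltW.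
  by move: si sj; rewrite !truncn_mesh // => /eqP <- /eqP.
- by move=> k _; apply: measurableX => //; apply: measurable_itv.
have mk k : (P \x (@lebesgue_measure R))%E (E k `*` `[k%:R * h, k.+1%:R * h[%classic) =
    (u k * h)%:E.
  rewrite product_measure1E //.
  rewrite [X in (X * _)%E](PE k) [X in (_ * X)%E]lebesgue_measure_itv /= lte_fin.
  rewrite ltr_pM2r // ltr_nat ltnSn -EFinB -EFinM; congr (_ * _)%:E.
  by rewrite -natr1; ring.
apply: cvg_lim => //.
have -> : (fun n : nat => \sum_(0 <= i < n | i \in setT)
    (P \x (@lebesgue_measure R)) (E i `*` `[(i%:R * h)%R, (i.+1%:R * h)%R[%classic))%E =
    EFin \o (fun n => h * series u n).
  apply/funext => n /=; rewrite (eq_bigl xpredT) => [|i]; last by rewrite in_setT.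
  rewrite (eq_bigr _ (fun i _ => mk i)) sumEFin; congr EFin.
  by rewrite -mulr_suml mulrC.
by apply: cvg_EFin; [exact: nearW | exact: cvgMl_tmp].
Qed.

End grid.

Section occupation.
Context {R : realType} {S : finType} {d : measure_display}
  {Omega : measurableType d}.
Variables (P : probability Omega R) (Q : S -> S -> R) (x : S).
Variable X : R -> Omega -> S.
Hypothesis hX : is_markov_chain P Q (point_law x) X.
Variable K : {set S}.
Variable t : R.
Hypothesis t_gt0 : 0 < t.

Definition occupation (y : S) : set (Omega * measurableTypeR R) :=
  [set z | [/\ 0 <= z.2, (z.2%:E < hit X K z.1)%E & X z.2 z.1 = y]].

(** On the cell from [k h] to [(k + 1) h] the state is read at the right end, hence [k.+1]:
    right-continuity controls the path only after [s]. *)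
Definition mesh_occupation y n := grid (t / 2 ^+ n)
  (fun k => avoid_event X predT (t / 2 ^+ n) K k.+1 y).

(** The dominating set for the limit in [n]: avoidance on the coarsest mesh is the weakest
    requirement. *)
Definition survival_region := grid t (fun k => avoid_event_any X predT t K k).

(** Before the hitting time, the next mesh point eventually shows the state at [s], and earlier ones
    avoid [K]. From the hitting time on, a mesh point just after [tau] eventually lies in [K], with
    index no larger than that of the right end of the cell of [s]. *)
Lemma mesh_occupation_eventually y z : exists N, forall n, (N <= n)%N ->
  mesh_occupation y n z <-> occupation y z.
Proof.
case: z => w s; have [s0|s0] := leP 0 s; last first.
  exists 0%N => n _; split=> [/gridE|[/=]]; last by rewrite leNgt s0.
  by move=> [|]; [exact: mesh_gt0 | rewrite leNgt s0].
have step n : s < (Num.truncn (s / (t / 2 ^+ n))).+1%:R * (t / 2 ^+ n)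
    <= s + t / 2 ^+ n by apply: truncn_mesh_next => //; apply: mesh_gt0.
have occE : occupation y (w, s) <-> (s%:E < hit X K w)%E /\ X s w = y.
  by split=> [[]|[]].
have [shit|hits] := ltP s%:E (hit X K w).
  have [e e0 he] := mc_right_continuous hX w s0.
  have XsK : X s w \notin K.
    move: shit; case: (hitP hX) => [never _|tau tau0 _ before]; first exact: never.
    by rewrite lte_fin => st; apply: before; rewrite s0.
  have before i (h : R) : 0 <= h -> i%:R * h <= s -> X (i%:R * h) w \notin K.
    move=> h0; move: shit; case: (hitP hX) => [never _ _|tau tau0 _ before].
      by apply: never; rewrite mulr_ge0.
    rewrite lte_fin => st ih; apply: before; rewrite mulr_ge0 //=.
    exact: le_lt_trans st.
  have [N hN] := near_mesh_lt t_gt0 e0.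
  exists N => n Nn; have hn := hN n Nn; have h0 := mesh_gt0 n t_gt0.
  have Xnext : X ((Num.truncn (s / (t / 2 ^+ n))).+1%:R * (t / 2 ^+ n)) w = X s w.
    apply: he; have /andP[a b] := step n; rewrite ltW //=.
    by rewrite (le_lt_trans b) // ltrD2l.
  apply: iff_trans (iff_sym occE); apply: iff_trans (gridE _ _ _ h0) _; split.
    by move=> [_ [_ _ <-]]; rewrite Xnext.
  move=> [_ Xsy]; split => //; split => //; last by rewrite Xnext.
  move=> i /andP[_]; rewrite leq_eqVlt => /orP[/eqP ->|]; first by rewrite Xnext.
  rewrite ltnS => ik; apply: before; first exact: ltW.
  have /andP[+ _] := truncn_mesh_itv h0 s0; apply: le_trans.
  by rewrite ler_wpM2r ?ler_nat // ltW.
have : (hit X K w <= s%:E)%E := hits.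
case: (hitP hX) (hits) => // tau tau0 Xtau _ _; rewrite lee_fin => taus.
have [e e0 he] := mc_right_continuous hX w tau0.
have [N hN] := near_mesh_lt t_gt0 e0.
exists N => n Nn; have hn := hN n Nn; have h0 := mesh_gt0 n t_gt0.
split; last by move=> /occE[+ _]; rewrite ltNge hits.
move=> /(gridE _ _ _ h0)[_ [_ avoid _]]; exfalso.
have /andP[lo hi] := truncn_mesh_next h0 tau0.
have k2 : (0 < (Num.truncn (tau / (t / 2 ^+ n))).+1
             <= (Num.truncn (s / (t / 2 ^+ n))).+1)%N.
  by rewrite /= ltnS le_truncn // ler_pM2r // invr_gt0.
have := avoid _ k2; rewrite he ?Xtau //.
by rewrite ltW //= (le_lt_trans hi) // ltrD2l.
Qed.

Lemma mesh_occupation_sub y n : mesh_occupation y n `<=` survival_region.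
Proof.
move=> [w s] /(gridE _ _ _ (mesh_gt0 n t_gt0))[s0 [_ avoid _]].
apply/(gridE _ _ _ t_gt0); split => //; split => // i /andP[i0 it].
have h0 := mesh_gt0 n t_gt0.
have -> : i%:R * t = (i * 2 ^ n)%:R * (t / 2 ^+ n).
  by rewrite natrM natrX; field; rewrite expf_neq0.
apply: avoid; rewrite muln_gt0 i0 expn_gt0 /=.
have sh0 : 0 <= s / (t / 2 ^+ n) by rewrite divr_ge0 // ltW.
apply: leqW; rewrite truncn_ge_nat //.
rewrite ler_pdivlMr // natrM natrX.
have : i%:R * t <= s.
  by rewrite -ler_pdivlMr // -truncn_ge_nat // divr_ge0 // ltW.
by apply: le_trans; rewrite -mulrA (mulrCA (2 ^+ n)) divff ?mulr1 ?expf_neq0.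
Qed.

Lemma measurable_mesh_occupation y n : measurable (mesh_occupation y n).
Proof.
apply: measurable_grid => k; apply: (measurable_avoid_event hX).
exact/ltW/mesh_gt0.
Qed.

Lemma measurable_survival_region : measurable survival_region.
Proof. by apply: measurable_grid => k; apply: (measurable_avoid_event_any hX); exact: ltW. Qed.

Lemma measurable_occupation y : measurable (occupation y).
Proof.
(* By eventual equality [occupation y] is the lower limit of the mesh sets. *)
have -> : occupation y = \bigcup_N \bigcap_(n in [set n | (N <= n)%N]) mesh_occupation y n.
  apply/seteqP; split => z.
    move=> oz; have [N hN] := mesh_occupation_eventually y z.
    by exists N => // n /= Nn; apply/hN.
  move=> [M _ hM]; have [N hN] := mesh_occupation_eventually y z.
  apply/(hN (maxn M N)); first exact: leq_maxr.
  by apply: hM => /=; exact: leq_maxl.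
apply: bigcup_measurable => N _; apply: bigcap_measurableType => n _.
exact: measurable_mesh_occupation.
Qed.

Hypothesis survival_summable : cvgn (series (fun k => survival (transition Q t) K k x)).

Local Notation mu := (P \x (@lebesgue_measure R))%E.

Lemma survival_region_lty : (mu survival_region < +oo)%E.
Proof.
rewrite (@measure_grid _ _ _ P t _ (fun k => survival (transition Q t) K k x)
  (limn (series (fun k => survival (transition Q t) K k x)))) ?ltry //.
  by move=> k; apply: (measurable_avoid_event_any hX); exact: ltW.
move=> k; rewrite (prob_avoid_event_any hX) ?(ltW t_gt0) //.
by rewrite (sum_point_law _ (D := predT)).
Qed.

Lemma cvg_mesh_occupation y :
  mu (mesh_occupation y n) @[n --> \oo] --> mu (occupation y).
Proof.
have mW := measurable_survival_region.
have mU := measurable_mesh_occupation y.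
have mO := measurable_occupation y.
have [] := @dominated_convergence _ _ R mu setT measurableT
  (fun n z => (\1_(mesh_occupation y n) z)%:E) (fun z => (\1_(occupation y) z)%:E)
  (fun z => (\1_survival_region z)%:E).
- by move=> n; apply/measurable_EFinP; apply: measurable_indic.
- by apply/measurable_EFinP; apply: measurable_indic.
- apply: aeW => z _; have [N hN] := mesh_occupation_eventually y z.
  apply: cvg_near_cst; exists N => // n /= Nn; congr EFin.
  rewrite !indicE; congr (nat_of_bool _)%:R.
  by apply/idP/idP; rewrite !inE => /(hN n Nn).
- apply/integrableP; split; first by apply/measurable_EFinP; apply: measurable_indic.
  under eq_integral do rewrite gee0_abs ?lee_fin //.
  by rewrite integral_indic // setIT survival_region_lty.
- apply: aeW => z n _; rewrite gee0_abs ?lee_fin // !indicE ler_nat.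
  have [/set_mem/mesh_occupation_sub/mem_set -> //|] := boolP (z \in mesh_occupation y n).
  by [].
move=> _ _; rewrite integral_indic // setIT; apply: cvg_trans.
apply: near_eq_cvg; apply: nearW => n /=.
by rewrite integral_indic // setIT.
Qed.

(** Reading right ends omits the visit at time 0, hence the subtracted Kronecker symbol. *)
Lemma measure_mesh_occupation y n :
  cvgn (series (fun k => killed_pow (transition Q (t / 2 ^+ n)) K k x y)) ->
  mu (mesh_occupation y n) =
  (t / 2 ^+ n * (green (transition Q (t / 2 ^+ n)) K x y - (x == y)%:R))%:E.
Proof.
move=> cv; have h0 := mesh_gt0 n t_gt0.
apply: (@measure_grid _ _ _ P _ _
  (fun k => killed_pow (transition Q (t / 2 ^+ n)) K k.+1 x y)) => //.
- by move=> k; apply: (measurable_avoid_event hX); exact: ltW.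
- move=> k; rewrite (prob_avoid_event hX) ?(ltW h0) //.
  by rewrite (sum_point_law (fun a => killed_pow _ _ _ a _) (D := predT)).
have -> : series (fun k => killed_pow (transition Q (t / 2 ^+ n)) K k.+1 x y) =
   (fun m => series (fun k => killed_pow (transition Q (t / 2 ^+ n)) K k x y) m.+1
             - (x == y)%:R).
  apply/funext => m; rewrite /series /= [in RHS]big_nat_recl //.
  by rewrite /killed_pow /= addrAC subrr add0r.
apply: cvgB; last exact: cvg_cst.
by rewrite cvg_shiftS.
Qed.

Lemma xsection_occupation y w : xsection (occupation y) w =
  [set s | [/\ 0 <= s, (s%:E < hit X K w)%E & X s w = y]].
Proof. by apply/seteqP; split => s; rewrite /xsection /= inE. Qed.

Lemma measurable_lifetime w :
  measurable [set s : measurableTypeR R | 0 <= s /\ (s%:E < hit X K w)%E].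
Proof.
case: (hitP hX) => [never|tau tau0 _ _].
  rewrite (_ : mkset _ = `[0, +oo[%classic); first exact: measurable_itv.
  by apply/seteqP; split => s /=; rewrite in_itv /= andbT ltry; [case | split].
rewrite (_ : mkset _ = `[0, tau[%classic); first exact: measurable_itv.
by apply/seteqP; split => s /=; rewrite in_itv /= lte_fin; [case=> -> -> | move/andP].
Qed.

Lemma local_timeE y w : local_time X K y w = lebesgue_measure (xsection (occupation y) w).
Proof.
have mx := measurable_xsection w (measurable_occupation y).
rewrite /local_time.
transitivity (\int[lebesgue_measure]_(s in
    [set s : measurableTypeR R | (0 <= s)%R /\ (s%:E < hit X K w)%E])
    (\1_(xsection (occupation y) w) s)%:E)%E.
  apply: eq_integral => s; rewrite inE /= => -[s0 sh].
  rewrite indicE; congr (nat_of_bool _)%:R%:E.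
  rewrite xsection_occupation; apply/eqP/idP => [Xs|]; first by rewrite inE.
  by rewrite inE => -[].
rewrite integral_indic //; last exact: measurable_lifetime.
congr (lebesgue_measure _); apply/setIidPl => s.
by rewrite xsection_occupation => -[].
Qed.

Lemma integral_local_time y : (\int[P]_w local_time X K y w)%E = mu (occupation y).
Proof. by apply: eq_integral => w _; rewrite local_timeE. Qed.

(** The current state partitions the lifetime, so the mean hitting time is a sum of the same
    occupation measures that form the numerators. *)
Lemma hit_local_time w : hit X K w = (\sum_y local_time X K y w)%E.
Proof.
rewrite (eq_bigr _ (fun y _ => local_timeE y w)).
have mx y := measurable_xsection w (measurable_occupation y).
rewrite -(measure_finType_union (@lebesgue_measure R) predT) //; last first.
  by move=> a b _ _ [s []]; rewrite !xsection_occupation => -[_ _ <-] [_ _ <-].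
have -> : \bigcup_(y in [set` predT]) xsection (occupation y) w =
   [set s : measurableTypeR R | 0 <= s /\ (s%:E < hit X K w)%E].
  apply/seteqP; split => s.
    by move=> [y _]; rewrite xsection_occupation => -[].
  by move=> [s0 sh]; exists (X s w) => //; rewrite xsection_occupation.
case: (hitP hX) => [never|tau tau0 _ _].
  have -> : [set s : measurableTypeR R | 0 <= s /\ (s%:E < +oo)%E] = `[0, +oo[%classic.
    by apply/seteqP; split => s /=; rewrite in_itv /= andbT ltry; [case | split].
  by rewrite [RHS]lebesgue_measure_itv /= ltry.
have -> : [set s : measurableTypeR R | 0 <= s /\ (s%:E < tau%:E)%E] = `[0, tau[%classic.
  by apply/seteqP; split => s /=; rewrite in_itv /= lte_fin; [case=> -> -> | move/andP].
rewrite [RHS]lebesgue_measure_itv /= lte_fin sube0.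
by case: ltP => // tau_le0; congr EFin; apply/eqP; rewrite eq_le tau0 tau_le0.
Qed.

Lemma integral_hit : (\int[P]_w hit X K w)%E = (\sum_y mu (occupation y))%E.
Proof.
transitivity (\int[P]_w (\sum_y lebesgue_measure (xsection (occupation y) w)))%E.
  apply: eq_integral => w _; rewrite hit_local_time; apply: eq_bigr => y _.
  exact: local_timeE.
rewrite ge0_integral_sum //.
by move=> y; apply: measurable_fun_xsection; exact: measurable_occupation.
Qed.

End occupation.

(** * Passage to the limit *)

(** The extremal test function is the indicator of [p < q]; equal masses make the absolute
    difference sum to twice its positive part. *)
Lemma d_TV_le (R : realType) (S : finType) (p q : S -> R) (b : R) :
  \sum_x p x = \sum_x q x ->
  (forall psi : S -> R, (forall y, 0 <= psi y <= 1) ->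
    \sum_y q y * psi y - \sum_y p y * psi y <= b) ->
  d_TV p q <= b.
Proof.
move=> pq hb; pose psi y : R := (p y < q y)%R%:R.
apply: le_trans (hb psi _); last by move=> y; rewrite /psi ler0n lern1 leq_b1.
have -> : \sum_y q y * psi y - \sum_y p y * psi y =
    2^-1 * \sum_y (2 * (q y - p y) * psi y - (q y - p y)).
  have e : \sum_y (q y - p y) = 0 by rewrite sumrB pq subrr.
  rewrite [in RHS]sumrB e subr0 -sumrB mulr_sumr.
  by apply: eq_bigr => y _; field.
rewrite ler_pM2l ?invr_gt0 // ler_sum // => y _; rewrite /psi.
by case: ltP => h; [rewrite ltr0_norm ?subr_lt0 | rewrite ger0_norm ?subr_ge0] => //=; lra.
Qed.

(** * The hypotheses on the skeletons, and the limit of their estimates *)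

Section assembly.
Variables (R : realType) (S : finType) (Q : S -> S -> R) (pi : S -> R).
Hypotheses (hirr : irreducible_rates Q) (hpi : invariant_prob Q pi).
Variables (disp : measure_display) (Omega : measurableType disp).
Variables (P : probability Omega R) (X Xrev : (S -> R) -> R -> Omega -> S).
Hypothesis hX : is_markov_family P Q X.
Variable G : {set S}.
Hypothesis hG : G != finset.set0.

Lemma sum_restricted_gt0 x : x \notin G -> 0 < \sum_(y in ~: G) pi y.
Proof.
move=> xG; rewrite (bigD1 x) ?inE //= ltr_pwDl ?(invariant_gt0 hX) //.
by apply: sumr_ge0 => y _; have [[]] := hpi.
Qed.

Lemma restricted_law_ge0 y : 0 <= restricted_law pi (~: G) y.
Proof.
have [[pi0 _] _] := hpi.
by rewrite /restricted_law divr_ge0 ?mulr_ge0 ?sumr_ge0 // => z _.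
Qed.

Lemma restricted_law_sum1 x : x \notin G -> \sum_y restricted_law pi (~: G) y = 1.
Proof.
move=> xG; have s0 := sum_restricted_gt0 xG.
rewrite /restricted_law -mulr_suml.
suff -> : \sum_y pi y * (y \in ~: G)%:R = \sum_(y in ~: G) pi y.
  by rewrite divff // gt_eqF.
rewrite [RHS]big_mkcond; apply: eq_bigr => y _.
by case: ifP => _; rewrite ?mulr1 ?mulr0.
Qed.

(** Invariance of [pi], with the nonnegative contributions of starts in [G] dropped. *)
Lemma restricted_law_sub t y : 0 <= t -> y \notin G ->
  \sum_x restricted_law pi (~: G) x * transition Q t x y <= restricted_law pi (~: G) y.
Proof.
move=> t0 yG; have [[pi0 _] _] := hpi.
rewrite [leRHS]/restricted_law inE yG mulr1 -(transition_invariant t y hpi) mulr_suml.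
apply: ler_sum => x _; rewrite /restricted_law mulrAC ler_wpM2r //.
  by rewrite invr_ge0 sumr_ge0 // => z _.
by rewrite mulrAC ler_piMr ?mulr_ge0 // ?lern1 ?leq_b1 // (transition_ge0 hX).
Qed.

Variables (alpha Rt d f r : R).
Hypotheses (Rt_gt0 : 0 < Rt) (f_ge0 : 0 <= f) (d_ge0 : 0 <= d) (r01 : 0 <= r < 1).
Hypothesis hHp : HpG P pi G X Xrev alpha Rt d f r.
Let B := basin P G X Xrev alpha Rt f.
Let eta := 2 * f `^ alpha.
Let h n := Rt / 2 ^+ n.
Let p n := transition Q (h n).

Let h_gt0 n : 0 < h n. Proof. exact: mesh_gt0. Qed.

Let NhE n : (2 ^ n)%:R * h n = Rt.
Proof. by rewrite natrX /h mulrCA divff ?mulr1 // expf_neq0. Qed.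

Lemma basinE z : z \in B -> z \notin G /\
  2^-1 * (prob_hit_le P (X (point_law z)) G (2 * Rt)
     + prob_hit_le P (Xrev (point_law z)) G (2 * Rt)) <= f `^ alpha.
Proof. by rewrite /B inE inE => /andP[]. Qed.

Lemma basin_notin z : z \in B -> z \notin G.
Proof. by move=> /basinE[]. Qed.

Let Rt2_gt0 : 0 < 2 * Rt. Proof. exact: mulr_gt0. Qed.

Lemma escape_mesh n x : x \notin G ->
  1 - f <= \sum_a restricted_law pi (~: G) a * survival (p n) G (2 ^ n) a.
Proof.
move=> xG; have [esc _ _] := hHp.
have hA : is_prob (restricted_law pi (~: G)).
  by split; [exact: restricted_law_ge0 | exact: restricted_law_sum1 xG].
have := @prob_hit_le_ge _ _ _ _ _ _ _ _ (hX hA) G (2 ^ n) (h n) (2 * Rt)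
  Rt2_gt0 (ltW (h_gt0 n)).
rewrite NhE => /(_ _)/le_trans/(_ esc); rewrite -/(p n).
have -> : Rt <= 2 * Rt by have := Rt_gt0; lra.
by move=> /(_ isT); lra.
Qed.

Lemma basin_survival_mesh n z : z \in B ->
  1 - eta <= survival (p n) G (2 ^ n + 2 ^ n) z.
Proof.
move=> /basinE[zG hz].
(* The mean of the forward and reversed probabilities is at most [f^alpha]; with the reversed one
   nonnegative, the forward one is at most [2 f^alpha], which is [eta]. *)
have rev0 : 0 <= prob_hit_le P (Xrev (point_law z)) G (2 * Rt) by exact: fine_ge0.
have := @prob_hit_le_ge _ _ _ _ _ _ _ _ (hX (is_prob_point_law z)) G
   (2 ^ n + 2 ^ n) (h n) (2 * Rt) Rt2_gt0 (ltW (h_gt0 n)).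
rewrite natrD mulrDl NhE (sum_point_law _ (D := predT)) // -/(p n).
have -> : Rt + Rt <= 2 * Rt by lra.
by move=> /(_ isT); rewrite /eta; lra.
Qed.

Lemma recurrence_mesh : \forall n \near \oo, forall y, y \notin B :|: G ->
  survival (p n) (B :|: G) (2 ^ n) y <= r.
Proof.
apply: filter_forall => y.
have [yK|_] := boolP (y \notin B :|: G); last by apply: nearW.
have [_ _ rec] := hHp.
have lt_r : prob_hit_gt P (X (point_law y)) (B :|: G) Rt < r.
  apply: le_lt_trans rec; apply: ub_le_sup; last by exists y.
  (* [sup] dominates its set only once the set is known to be bounded above. *)
  exists 1 => _ [z _ <-].
  rewrite -lee_fin fineK ?fin_num_measure ?probability_le1 //.
    exact: (measurable_lt_hit (hX (is_prob_point_law z))).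
  exact: (measurable_lt_hit (hX (is_prob_point_law z))).
have cv := cvg_prob_hit_gt (hX (is_prob_point_law y)) (K := B :|: G) Rt_gt0.
apply: filterS (cvgr_le _ cv _ lt_r) => n.
by rewrite (sum_point_law (survival _ _ _) (D := fun a => a \notin _)) // => h' _.
Qed.

Lemma mixing_mesh n z x : z \in B -> x \in B ->
  \sum_y `|killed_pow (p n) finset.set0 (2 ^ n) z y
         - killed_pow (p n) finset.set0 (2 ^ n) x y| <= 2 * d.
Proof.
move=> zB xB; have [_ mix _] := hHp.
have tv : d_TV (law_at P (X (point_law z)) Rt) (law_at P (X (point_law x)) Rt) <= d.
  apply: le_trans mix.
  apply: le_trans (le_bigmax_cond _ (fun z => \big[Num.max/0]_(x in B)
    d_TV (law_at P (X (point_law z)) Rt) (law_at P (X (point_law x)) Rt)) zB).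
  exact: (le_bigmax_cond _ (fun x =>
    d_TV (law_at P (X (point_law z)) Rt) (law_at P (X (point_law x)) Rt)) xB).
move: tv; rewrite /d_TV ler_pdivrMl // => tv; apply: le_trans tv.
rewrite le_eqVlt; apply/orP; left; apply/eqP; apply: eq_bigr => y _.
rewrite !(transition_iter hX) ?ltW // NhE /law_at.
by rewrite !(law_transition hX) // ltW.
Qed.

Lemma p_gt0 n a b : 0 < p n a b.
Proof. exact: (transition_gt0 hX). Qed.

Lemma p_sum1 n a : \sum_b p n a b = 1.
Proof. by rewrite (transition_sum1 hX) // ltW. Qed.

Variable x : S.
Hypothesis xB : x \in B.

Local Notation mu := (P \x (@lebesgue_measure R))%E.
Local Notation occ := (occupation (X (point_law x)) G).

Let hx := hX (is_prob_point_law x).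

Lemma summable_survival : cvgn (series (fun k => survival (transition Q Rt) G k x)).
Proof.
have [q /andP[q0 q1] hq] := survival_geometric (p_gt0 0) (p_sum1 0) hG.
have -> : transition Q Rt = p 0 by rewrite /p /h expr0 divr1.
apply: (@series_le_cvg _ _ (geometric 1 q)).
- by move=> k; apply: survival_ge0 => a b; exact/ltW/p_gt0.
- by move=> k; rewrite /geometric /= mul1r exprn_ge0.
- by move=> k; rewrite /geometric /= mul1r.
- by apply: is_cvg_geometric_series; rewrite ger0_norm.
Qed.

Lemma occupation_lty y : (mu (occ y) < +oo)%E.
Proof.
apply: le_lt_trans (survival_region_lty hx Rt_gt0 summable_survival).
apply: le_measure; rewrite ?inE.
- exact: (measurable_occupation hx _ Rt_gt0).
- exact: (measurable_survival_region hx _ Rt_gt0).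
move=> z oz; have [N hN] := mesh_occupation_eventually hx G Rt_gt0 y z.
exact: (mesh_occupation_sub Rt_gt0 ((hN N (leqnn _)).2 oz)).
Qed.

Let T y : R := fine (mu (occ y)).

Let TE y : mu (occ y) = (T y)%:E.
Proof. by rewrite fineK // ge0_fin_numE // occupation_lty. Qed.

Lemma cvg_green_occupation y : h n * green (p n) G x y @[n --> \oo] --> T y.
Proof.
have cv := cvg_mesh_occupation hx Rt_gt0 summable_survival (y := y).
rewrite TE in cv.
have {}cv : h n * (green (p n) G x y - (x == y)%:R) @[n --> \oo] --> T y.
  suff <- : fine \o (fun n => mu (mesh_occupation (X (point_law x)) G Rt y n)) =
      (fun n => h n * (green (p n) G x y - (x == y)%:R)) by exact: fine_cvg cv.
  apply/funext => n /=; rewrite (measure_mesh_occupation hx Rt_gt0) //.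
  exact: (is_cvg_green (p_gt0 n) (p_sum1 n) hG).
have h0 : h n @[n --> \oo] --> (0 : R).
  apply/cvgrPdist_lt => e e0; have [N hN] := near_mesh_lt Rt_gt0 e0.
  by exists N => // n /= Nn; rewrite sub0r normrN gtr0_norm // hN.
have {}h0 : h n * (x == y)%:R @[n --> \oo] --> (0 * (x == y)%:R : R) by exact: cvgMr_tmp.
have cvD := cvgD cv h0; rewrite mul0r addr0 in cvD.
suff <- : (fun n => h n * (green (p n) G x y - (x == y)%:R)) + (fun n => h n * (x == y)%:R) =
  (fun n => h n * green (p n) G x y) by exact: cvD.
by apply/funext => n; rewrite fctE; ring.
Qed.

Hypothesis eta_lt1 : eta < 1.

Lemma mesh_lln psi : (forall y, 0 <= psi y <= 1) -> \forall n \near \oo,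
  \sum_y restricted_law pi (~: G) y * psi y
    - (\sum_y green (p n) G x y * psi y) / \sum_y green (p n) G x y
    <= 4 * (r + eta + f + eta / 2 + d)
  /\ (2 ^ n)%:R * (1 - eta) <= \sum_y green (p n) G x y.
Proof.
move=> psi01; have xG := basin_notin xB.
apply: filterS recurrence_mesh => n rec.
apply: (green_lln (B := B) (p_gt0 n) (p_sum1 n) hG) => //.
- exact: basin_notin.
- exact: restricted_law_ge0.
- by move=> y yG; rewrite /restricted_law inE yG mulr0 mul0r.
- exact: restricted_law_sum1 xG.
- by move=> y yG; apply: restricted_law_sub => //; exact: ltW.
- exact: escape_mesh xG.
- exact: basin_survival_mesh.
- exact: mixing_mesh.
- by rewrite expn_gt0.
- by rewrite /eta mulr_ge0 // powR_ge0.
Qed.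

(** The bound [Rt * (1 - eta)] on the mean exit time, the second conclusion of [mesh_lln], persists
    in the limit. *)
Lemma occupation_sum_gt0 : 0 < \sum_y T y.
Proof.
have cv : \sum_y h n * green (p n) G x y @[n --> \oo] --> \sum_y T y.
  by apply: cvg_big => [|y _]; [exact: add_continuous | exact: cvg_green_occupation].
apply: (@lt_le_trans _ _ (Rt * (1 - eta))); first by rewrite mulr_gt0 // subr_gt0.
apply: (cvgr_to_ge cv).
have psi0 (y : S) : 0 <= (0 : R) <= 1 by rewrite lexx ler01.
apply: filterS (mesh_lln psi0) => n [_ hn].
by rewrite -mulr_sumr -(NhE n) mulrAC mulrC ler_wpM2l ?(ltW (h_gt0 n)).
Qed.

Lemma time_occupation_lln psi : (forall y, 0 <= psi y <= 1) ->
  \sum_y restricted_law pi (~: G) y * psi y - (\sum_y T y * psi y) / \sum_y T y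
    <= 4 * (r + eta + f + eta / 2 + d).
Proof.
move=> psi01; have T0 := occupation_sum_gt0.
have cv1 : \sum_y h n * green (p n) G x y @[n --> \oo] --> \sum_y T y.
  by apply: cvg_big => [|y _]; [exact: add_continuous | exact: cvg_green_occupation].
have cv2 : \sum_y h n * green (p n) G x y * psi y @[n --> \oo] --> \sum_y T y * psi y.
  apply: cvg_big => [|y _]; first exact: add_continuous.
  by apply: cvgMr_tmp; exact: cvg_green_occupation.
have T_neq0 : \sum_y T y != 0 by rewrite gt_eqF.
pose C := \sum_y restricted_law pi (~: G) y * psi y.
have cv : C - (\sum_y h n * green (p n) G x y * psi y) / (\sum_y h n * green (p n) G x y)
    @[n --> \oo] --> C - (\sum_y T y * psi y) / \sum_y T y.
  by apply: cvgB; [exact: cvg_cst | apply: cvgM => //; exact: cvgV].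
apply: (cvgr_to_le cv); apply: filterS (mesh_lln psi01) => n [hn _].
apply: le_trans hn; rewrite lerD2l lerN2.
(* The mesh width [h n] cancels in the ratio. *)
under [X in _ <= X / _]eq_bigr do rewrite -mulrA.
by rewrite -!mulr_sumr invfM mulrACA divff ?mul1r // gt_eqF.
Qed.

Lemma empirical_lawE y : empirical_law P (X (point_law x)) G y = T y / \sum_z T z.
Proof.
rewrite /empirical_law (integral_local_time hx G Rt_gt0) (integral_hit hx G Rt_gt0).
rewrite (eq_bigr _ (fun z _ => TE z)) sumEFin /=.
by rewrite TE.
Qed.

Lemma d_TV_empirical_le :
  d_TV (empirical_law P (X (point_law x)) G) (restricted_law pi (~: G))
    <= 4 * (r + eta + f + eta / 2 + d).
Proof.
have T_neq0 : \sum_y T y != 0 by rewrite gt_eqF // occupation_sum_gt0.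
apply: d_TV_le => [|psi psi01].
  rewrite (restricted_law_sum1 (basin_notin xB)) (eq_bigr _ (fun y _ => empirical_lawE y)).
  by rewrite -mulr_suml divff.
apply: le_trans (time_occupation_lln psi01); rewrite lerD2l lerN2 mulr_suml.
by apply: ler_sum => y _; rewrite empirical_lawE mulrAC.
Qed.

End assembly.

Theorem corollary3p5 (R : realType) (S : finType)
  (Q : S -> S -> R) (pi : S -> R)
  (hQ : is_generator Q) (hirr : irreducible_rates Q)
  (hpi : invariant_prob Q pi)
  (disp : measure_display) (Omega : measurableType disp)
  (P : probability Omega R)
  (X Xrev : (S -> R) -> R -> Omega -> S)
  (hX : is_markov_family P Q X)
  (hXrev : is_markov_family P (reversed_rates Q pi) Xrev)
  (G : {set S}) (hG : G != finset.set0)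
  (alpha Rt d f r : R)
  (halpha : 0 < alpha < 1) (hRt : 1 < Rt)
  (hd : 0 < d < 1) (hf : 0 < f < 1) (hr : 0 < r < 1)
  (hHp : HpG P pi G X Xrev alpha Rt d f r)
  (hc : r + 2 * f `^ alpha < 4^-1) :
  let c := r + 2 * f `^ alpha in
  let cbar := 2^-1 - Num.sqrt (4^-1 - c) in
  let eps1 := 4 * (cbar + 2 * f + f `^ alpha + d) in
  forall x : S, x \in basin P G X Xrev alpha Rt f ->
    d_TV (empirical_law P (X (point_law x)) G) (restricted_law pi (~: G))
      < eps1.
Proof.
move=> c cbar eps1 x xB.
have /andP[d0 _] := hd; have /andP[f0 _] := hf; have /andP[r0 r1] := hr.
have phi0 : 0 <= f `^ alpha by exact: powR_ge0.
have c4 : c < 4^-1 := hc.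
have cE : c = r + 2 * f `^ alpha by [].
have c0 : 0 <= c by lra.
(* [(1/2 - c)^2 = 1/4 - c + c^2], so this says [c <= cbar]. *)
have sqrt_le : Num.sqrt (4^-1 - c) <= 2^-1 - c.
  rewrite -[leRHS]ger0_norm; last lra.
  by rewrite -sqrtr_sqr ler_wsqrtr //; nra.
have Rt0 : 0 < Rt := lt_trans ltr01 hRt.
have r01 : 0 <= r < 1 by rewrite ltW.
have phi1 : 2 * f `^ alpha < 1 by lra.
(* Here [r + eta] is [c] and [eta / 2] is [f^alpha]; strictness comes from [f < 2 * f]. *)
apply: le_lt_trans (d_TV_empirical_le hirr hpi hX hG Rt0 (ltW f0) (ltW d0) r01 hHp xB phi1) _.
rewrite /eps1 ltr_pM2l // /cbar; lra.
Qed.
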